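(* Suppose $\psi$ is $\bar\mu$-strongly convex for some $\bar\mu>0$, $\psi_n$ is $M_n$-Lipschitz continuous on $\operatorname{dom}\psi_n$, and there exists $\bar z\in\operatorname{int}(\operatorname{dom}\psi_n)$ with $\mathcal A\bar z=b$. Let $$K:=2+\left\lceil\log_\alpha^+\left(\max\left\{\frac{4\alpha^2D(M_n+\nabla_s+\tilde\epsilon_1)}{\hat\epsilon\,c_1\bar d\,\sigma_{\mathcal A}^+},\frac{2\alpha^2\|p_0\|}{\hat\epsilon c_1}\right\}\right)\right\rceil.$$ Assume APF-IAL is run with inputs $z_0\in\operatorname{dom}\psi_n$, $p_0\in\mathbb R^m$, $(\hat\epsilon,\hat\rho)\in\mathbb R_{++}^2$, $c_1>0$, $\alpha>1$, $\omega>1$, $\tilde\epsilon_1\ge\hat\rho$, and that in each iteration $k$ it calls R-FISTA as subproblem solver with inputs $\chi\in(0,1)$, $\mu_0\ge\bar\mu$, $\bar M_0=M_0$, tolerance $\epsilon_k$, function pair $(\mathcal L^s_{c_k}(\cdot,p_{k-1}),\psi_n)$, and initial point $z_{k-1}$. Then APF-IAL performs at most $$\mathcal O_1\left(\left\lceil\log_2^{++}(\mu_0/\bar\mu)\right\rceil\left[K\sqrt{\frac{\bar L}{\bar\mu}}+\sqrt{\frac{\|\mathcal A\|^2}{\hat\epsilon\bar\mu}}\right]\log^{++}\left(\frac{D(\bar L+\|\mathcal A\|^2/\hat\epsilon)}{\hat\rho}\right)\right)$$ gradient evaluations to obtain an $(\hat\epsilon,\hat\rho)$-approximate solution, i.e.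 a triple $(z,p,r)$ with $r\in\nabla\psi_s(z)+\partial\psi_n(z)+\mathcal A^*p$, $\|r\|\le\hat\rho$, $\|\mathcal Az-b\|\le\hat\epsilon$. Consequently, APF-IAL performs at most $\mathcal O(\hat\epsilon^{-1/2}\log(1/\hat\epsilon))$ total gradient evaluations to obtain an $(\hat\epsilon,\hat\epsilon)$-approximate solution.
   Context: Problem: $\min\{\psi(z):=\psi_s(z)+\psi_n(z):\mathcal Az=b\}$, where $\mathbb E$ is a finite-dimensional Euclidean space, $\mathcal A:\mathbb E\to\mathbb R^m$ is a nonzero linear map with adjoint $\mathcal A^*$, $b\in\mathbb R^m$; $\psi_s:\mathbb E\to\mathbb R$ is convex, differentiable with $\bar L$-Lipschitz gradient ($\bar L>0$); $\psi_n$ is closed proper convex with compact convex domain $\operatorname{dom}\psi_n$ of diameter $D$. $\mathcal L_c^s(z,p)=\psi_s(z)+\langle p,\mathcal Az-b\rangle+\frac c2\|\mathcal Az-b\|^2$. $\bar d=\operatorname{dist}(\bar z,\operatorname{bd}(\operatorname{dom}\psi_n))$, $\nabla_s=\sup_{z\in\operatorname{dom}\psi_n}\|\nabla\psi_s(z)\|$, $\sigma^+_{\mathcal A}$ is the smallest positive singular value of $\mathcal A$. $M_0=\|\nabla\psi_s(z_0)-\nabla\psi_s(w_0)\|/(4\|z_0-w_0\|)$ with $w_0\in\operatorname{dom}\psi_n$, $w_0\ne z_0$, $\nabla\psi_s(w_0)\ne\nabla\psi_s(z_0)$ (if $\psi_s$ is affine, $M_0>0$ is arbitrary and $\bar L$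 is taken large enough that $M_0\le2\bar L$). APF-IAL with R-FISTA: for $k=1,2,\dots$: set $\epsilon_k=\max\{\tilde\epsilon_k,\hat\rho\}$ if $\|\mathcal Az_{k-1}-b\|>\hat\epsilon$, and $\epsilon_k=\hat\rho$ otherwise; run R-FISTA with the inputs in the claim and call its output $(z_k,r_k)$; set $p_k=p_{k-1}+c_k(\mathcal Az_k-b)$, $c_{k+1}=\alpha c_k$, $\tilde\epsilon_{k+1}=\tilde\epsilon_k/\omega$; stop as soon as $\|\mathcal Az_k-b\|\le\hat\epsilon$ and $\|r_k\|\le\hat\rho$, and output $(z_k,p_k,r_k)$. R-FISTA for a generic pair $(f,h)$, $f$ convex with Lipschitz gradient, $h$ closed proper convex with compact domain (inputs $\chi\in(0,1)$, $(\mu_0,\bar M_0)\in\mathbb R_{++}^2$, tolerance $\epsilon>0$, $(f,h)$, $\bar x_0\in\operatorname{dom}h$). With $\ell_f(z;\bar z)=f(\bar z)+\langle\nabla f(\bar z),z-\bar z\rangle$, it runs cycles $\ell=1,2,\dots$. Initialization of cycle $\ell$: choose $\underline M_\ell\in[\max\{0.25\bar M_{\ell-1},\bar M_0\},\bar M_{\ell-1}]$, set $\tilde\mu=\mu_{\ell-1}$, $(A_0,\tau_0,L_0)=(0,1,\underline M_\ell)$, choose $x_0\in\operatorname{dom}h$ (with $x_0=\bar x_0$ if $\ell=1$), $y_0=x_0$. For $j=1,2,\dots$: (1) set $L_j=L_{j-1}$ and compute $a_{j-1}=\frac{\tau_{j-1}+\sqrt{\tau_{j-1}^2+4\tau_{j-1}A_{j-1}L_j}}{2L_j}$,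 $\tilde x_{j-1}=\frac{A_{j-1}y_{j-1}+a_{j-1}x_{j-1}}{A_{j-1}+a_{j-1}}$, $y_j=\operatorname{prox}_{(1/L_j)h}(\tilde x_{j-1}-\frac1{L_j}\nabla f(\tilde x_{j-1}))$; while $\ell_f(y_j;\tilde x_{j-1})+\frac{(1-\chi)L_j}{4}\|y_j-\tilde x_{j-1}\|^2<f(y_j)$, replace $L_j$ by $2L_j$ and recompute; (2) set $A_j=A_{j-1}+a_{j-1}$, $\tau_j=\tau_{j-1}+\frac{a_{j-1}\tilde\mu}2$, $s_j=L_j(\tilde x_{j-1}-y_j)$, $x_j=\frac1{\tau_j}\left[\frac{\tilde\mu a_{j-1}y_j}2+\tau_{j-1}x_{j-1}-a_{j-1}s_j\right]$, $v_j=\nabla f(y_j)-\nabla f(\tilde x_{j-1})+s_j$; (3) if $\|y_j-x_0\|^2\ge\chi A_jL_j\|y_j-\tilde x_{j-1}\|^2$ fails, set $\bar M_\ell=L_j$, $\mu_\ell=0.5\tilde\mu$ and start cycle $\ell+1$; otherwise, if $\|v_j\|\le\epsilon$, stop and output $(y_j,v_j)$. Notation: $\log_b^+(t)=\max\{\log_bt,0\}$ (equal to $0$ at $t=0$), $\log_b^{++}(t)=\max\{\log_bt,1\}$, natural log if no base; $\mathcal O_1(\cdot)=\mathcal O(1+\cdot)$. Asymptotic convention: $\mathcal O$, $\mathcal O_1$ are for tolerances tending to zero (say $\hat\epsilon,\hat\rho\in(0,1]$) with all other data and inputs fixed; implied constants are independent of $\hat\epsilon,\hat\rho$. *)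

(* Defs.v *)
From HB Require Import structures.
From mathcomp Require Import all_boot all_order all_algebra.
From mathcomp Require Import all_classical all_reals all_analysis.

Set Implicit Arguments.
Unset Strict Implicit.
Unset Printing Implicit Defensive.

Import Order.TTheory GRing.Theory Num.Theory.
Import numFieldNormedType.Exports.

Local Open Scope classical_set_scope.
Local Open Scope ring_scope.

Section Logarithms.
Context {R : realType}.

Definition logb (b t : R) : R := ln t / ln b.

(* [ln 0 = 0] in the library, so [logb_plus b 0 = 0]. *)
Definition logb_plus (b t : R) : R := Num.max (logb b t) 0.

Definition logb_plus2 (b t : R) : R := Num.max (logb b t) 1.

Definition ln_plus2 (t : R) : R := Num.max (ln t) 1.

Definition ceilR (t : R) : R := (Num.ceil t)%:~R.

End Logarithms.

(* The library norm on matrices is the max norm; R^m carries the Euclidean one,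
   so its inner product and norm are written out. *)
Section EuclideanRm.
Context {R : realType} {m : nat}.

Definition edot (u v : 'cV[R]_m) : R := \sum_i u i 0 * v i 0.

Definition enorm (u : 'cV[R]_m) : R := Num.sqrt (edot u u).

End EuclideanRm.

(* A finite-dimensional Euclidean space is a normed module with an inner product
   that induces its norm (hence its library topology) and a finite spanning
   family. *)
Definition is_euclidean {R : realType} {E : normedModType R}
    (ip : E -> E -> R) : Prop :=
  (forall x : E, `|x| = Num.sqrt (ip x x)) /\
  exists (n : nat) (e : 'I_n -> E),
    forall x : E, exists c : 'I_n -> R, x = \sum_i c i *: e i.

Section ConvexAnalysis.
Context {R : realType} {E : normedModType R}.
Variable ip : E -> E -> R.

Definition diam_set (D : set E) : R :=
  sup [set d | exists x y : E, [/\ D x, D y & d = `|x - y|]].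

Definition boundary (D : set E) : set E := closure D `\` interior D.

Definition dist_set (x : E) (D : set E) : R := inf [set `|x - y| | y in D].

Definition effdom (h : E -> \bar R) : set E := [set z | (h z < +oo)%E].

Definition proper_fun (h : E -> \bar R) : Prop :=
  (forall z, h z <> -oo%E) /\ effdom h !=set0.

Definition closed_fun (h : E -> \bar R) : Prop :=
  closed [set zt : E * R | (h zt.1 <= zt.2%:E)%E].

Definition strongly_convex_fun (mu : R) (h : E -> \bar R) : Prop :=
  forall (x y : E) (t : R), 0 < t < 1 ->
    (h (t *: x + (1 - t) *: y)%R
       + (mu / 2 * t * (1 - t) * `|x - y| ^+ 2)%:E
     <= t%:E * h x + (1 - t)%:E * h y)%E.

Definition convex_fun (h : E -> \bar R) : Prop :=
  forall (x y : E) (t : R), 0 < t < 1 ->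
    (h (t *: x + (1 - t) *: y)%R <= t%:E * h x + (1 - t)%:E * h y)%E.

Definition subdiff (h : E -> \bar R) (z : E) : set E :=
  [set g | forall u, (h z + (ip g (u - z))%:E <= h u)%E].

Definition grad (f : E -> R) (z : E) : E :=
  xget 0 [set g | forall v, 'd (f : E -> R^o) z v = ip g v].

Definition proxmap (lam : R) (h : E -> \bar R) (x : E) : E :=
  xget 0 [set y | forall u,
    (h y + ((2 * lam)^-1 * `|y - x| ^+ 2)%:E
     <= h u + ((2 * lam)^-1 * `|u - x| ^+ 2)%:E)%E].

Definition affine_fun (f : E -> R) : Prop :=
  exists (g : E) (c : R), forall z, f z = ip g z + c.

Definition linearize (f : E -> R) (z zbar : E) : R :=
  f zbar + ip (grad f zbar) (z - zbar).

End ConvexAnalysis.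

Section LinearMaps.
Context {R : realType} {E : normedModType R} {m : nat}.
Variable ip : E -> E -> R.
Variable A : E -> 'cV[R]_m.

Definition adjoint (q : 'cV[R]_m) : E :=
  xget 0 [set u | forall z, edot (A z) q = ip z u].

Definition opnorm : R := sup [set enorm (A z) | z in [set z : E | `|z| <= 1]].

(* A positive singular value is a positive square root of an eigenvalue of
   A^* A; there are finitely many of them, so the infimum is attained. *)
Definition sigma_plus : R :=
  inf [set s | 0 < s /\ exists2 v : E, v <> 0 & adjoint (A v) = s ^+ 2 *: v].

End LinearMaps.

(* Nondeterministic machines whose transition [step s q s'] performs [q]
   gradient evaluations. [all_runs_reach step Q s N] says that every execution
   from [s] gets to a state in [Q], without getting stuck or running forever,
   after at most [N] gradient evaluations. *)
Section Runs.
Variables (S : Type) (step : S -> nat -> S -> Prop) (Q : S -> Prop).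

Inductive all_runs_reach : S -> nat -> Prop :=
| Reach_now s N : Q s -> all_runs_reach s N
| Reach_later s N :
    (exists q s', step s q s') ->
    (forall q s', step s q s' -> (q <= N)%N) ->
    (forall q s', step s q s' -> all_runs_reach s' (N - q)%N) ->
    all_runs_reach s N.

End Runs.

Section RFISTA.
Context {R : realType} {E : normedModType R}.
Variable ip : E -> E -> R.
Variables (f : E -> R) (h : E -> \bar R).
Variables (chi Mbar0 eps : R) (xbar0 : E).

(* The data of a trial at iteration j of a cycle:
   A_{j-1}, tau_{j-1}, the current value of L_j, x_{j-1}, y_{j-1}. *)
Record trial := Trial
  { tr_A : R; tr_tau : R; tr_L : R; tr_x : E; tr_y : E }.

Definition tr_a (t : trial) : R :=
  (tr_tau t + Num.sqrt (tr_tau t ^+ 2 + 4 * tr_tau t * tr_A t * tr_L t))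
  / (2 * tr_L t).

Definition tr_xt (t : trial) : E :=
  (tr_A t + tr_a t)^-1 *: (tr_A t *: tr_y t + tr_a t *: tr_x t).

Definition tr_ynew (t : trial) : E :=
  proxmap (tr_L t)^-1 h (tr_xt t - (tr_L t)^-1 *: grad ip f (tr_xt t)).

Definition tr_backtrack (t : trial) : Prop :=
  linearize ip f (tr_ynew t) (tr_xt t)
    + (1 - chi) * tr_L t / 4 * `|tr_ynew t - tr_xt t| ^+ 2
  < f (tr_ynew t).

Definition tr_double (t : trial) : trial :=
  Trial (tr_A t) (tr_tau t) (2 * tr_L t) (tr_x t) (tr_y t).

Definition tr_Anew (t : trial) : R := tr_A t + tr_a t.

Definition tr_taunew (mu : R) (t : trial) : R := tr_tau t + tr_a t * mu / 2.

Definition tr_s (t : trial) : E := tr_L t *: (tr_xt t - tr_ynew t).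

Definition tr_xnew (mu : R) (t : trial) : E :=
  (tr_taunew mu t)^-1 *:
    ((mu * tr_a t / 2) *: tr_ynew t + tr_tau t *: tr_x t - tr_a t *: tr_s t).

Definition tr_v (t : trial) : E :=
  grad ip f (tr_ynew t) - grad ip f (tr_xt t) + tr_s t.

Definition tr_next (mu : R) (t : trial) : trial :=
  Trial (tr_Anew t) (tr_taunew mu t) (tr_L t) (tr_xnew mu t) (tr_ynew t).

Definition tr_check (x0 : E) (t : trial) : Prop :=
  `|tr_ynew t - x0| ^+ 2
  >= chi * tr_Anew t * tr_L t * `|tr_ynew t - tr_xt t| ^+ 2.

(* [NewCycle l M mu]: about to start cycle l, with M = Mbar_{l-1} and
   mu = mu_{l-1}. [Search l mu x0 t]: in cycle l, with mu = mu~. *)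
Inductive rfista_state :=
| NewCycle of nat & R & R
| Search of nat & R & E & trial
| Output of E & E.

(* A rejected trial evaluates the gradient at x~; an accepted one evaluates it
   at x~ and at y_j. *)
Inductive rfista_step : rfista_state -> nat -> rfista_state -> Prop :=
| Step_init l M mu Mlow x0 :
    Num.max (M / 4) Mbar0 <= Mlow <= M ->
    effdom h x0 -> (l = 1%N -> x0 = xbar0) ->
    rfista_step (NewCycle l M mu) 0
                (Search l mu x0 (Trial 0 1 Mlow x0 x0))
| Step_backtrack l mu x0 t :
    tr_backtrack t ->
    rfista_step (Search l mu x0 t) 1 (Search l mu x0 (tr_double t))
| Step_restart l mu x0 t :
    ~ tr_backtrack t -> ~ tr_check x0 t ->
    rfista_step (Search l mu x0 t) 2 (NewCycle l.+1 (tr_L t) (mu / 2))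
| Step_continue l mu x0 t :
    ~ tr_backtrack t -> tr_check x0 t -> eps < `|tr_v t| ->
    rfista_step (Search l mu x0 t) 2 (Search l mu x0 (tr_next mu t))
| Step_output l mu x0 t :
    ~ tr_backtrack t -> tr_check x0 t -> `|tr_v t| <= eps ->
    rfista_step (Search l mu x0 t) 2 (Output (tr_ynew t) (tr_v t)).

End RFISTA.

Section APFIAL.
Context {R : realType} {E : normedModType R} {m : nat}.
Variable ip : E -> E -> R.
Variables (A : E -> 'cV[R]_m) (b : 'cV[R]_m).
Variables (psi_s : E -> R) (psi_n : E -> \bar R).

Definition aug_lagr (c : R) (p : 'cV[R]_m) (z : E) : R :=
  psi_s z + edot p (A z - b) + c / 2 * enorm (A z - b) ^+ 2.

Definition approx_solution (ehat rhat : R) (z : E) (p : 'cV[R]_m) (r : E)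
    : Prop :=
  [/\ exists2 g, subdiff ip psi_n z g
                 & r = grad ip psi_s z + g + adjoint ip A p,
      `|r| <= rhat & enorm (A z - b) <= ehat].

(* [ApfSolve z p c et eps s]: the call to R-FISTA of iteration k is in state
   [s], with z = z_{k-1}, p = p_{k-1}, c = c_k, et = epstilde_k, eps = eps_k.
   [ApfStart] precedes the computation of M_0. *)
Inductive apf_state :=
| ApfStart
| ApfSolve of E & 'cV[R]_m & R & R & R & rfista_state (E := E)
| ApfOutput of E & 'cV[R]_m & E.

Variables (chi mu0 M0 alpha omega : R).
Variables (z0 : E) (p0 : 'cV[R]_m) (c1 et1 ehat rhat : R).

Definition apf_tol (z : E) (et : R) : R :=
  if ehat < enorm (A z - b) then Num.max et rhat else rhat.

Definition apf_call (z : E) (p : 'cV[R]_m) (c et : R) : apf_state :=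
  ApfSolve z p c et (apf_tol z et) (NewCycle 1 M0 mu0).

Definition apf_mult (p : 'cV[R]_m) (c : R) (z : E) : 'cV[R]_m :=
  p + c *: (A z - b).

Definition apf_stop (z r : E) : Prop :=
  enorm (A z - b) <= ehat /\ `|r| <= rhat.

(* The two gradient evaluations at the start are those defining M_0. *)
Inductive apf_step : apf_state -> nat -> apf_state -> Prop :=
| Apf_start : apf_step ApfStart 2 (apf_call z0 p0 c1 et1)
| Apf_inner z p c et eps s q s' :
    rfista_step ip (aug_lagr c p) psi_n chi M0 eps z s q s' ->
    apf_step (ApfSolve z p c et eps s) q (ApfSolve z p c et eps s')
| Apf_stop z p c et eps z' r :
    apf_stop z' r ->
    apf_step (ApfSolve z p c et eps (Output z' r)) 0
             (ApfOutput z' (apf_mult p c z') r)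
| Apf_next z p c et eps z' r :
    ~ apf_stop z' r ->
    apf_step (ApfSolve z p c et eps (Output z' r)) 0
             (apf_call z' (apf_mult p c z') (alpha * c) (et / omega)).

Definition apf_success (s : apf_state) : Prop :=
  if s is ApfOutput z p r then approx_solution ehat rhat z p r else False.

(* Every execution of APF-IAL outputs an (ehat, rhat)-approximate solution after
   at most [N] gradient evaluations. *)
Definition apf_solves_within (N : nat) : Prop :=
  all_runs_reach apf_step apf_success ApfStart N.

Definition grad_sup : R :=
  sup [set `|grad ip psi_s z| | z in effdom psi_n].

Definition outer_bound (Mn : R) (zbar : E) : R :=
  2 + ceilR (logb_plus alpha
        (Num.max
          (4 * alpha ^+ 2 * diam_set (effdom psi_n) * (Mn + grad_sup + et1)
           / (ehat * c1 * dist_set zbar (boundary (effdom psi_n)) * sigma_plus ip A))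
          (2 * alpha ^+ 2 * enorm p0 / (ehat * c1)))).

Definition apf_bound (Lbar mubar Mn : R) (zbar : E) : R :=
  ceilR (logb_plus2 2 (mu0 / mubar))
  * (outer_bound Mn zbar * Num.sqrt (Lbar / mubar)
     + Num.sqrt (opnorm A ^+ 2 / (ehat * mubar)))
  * ln_plus2 (diam_set (effdom psi_n) * (Lbar + opnorm A ^+ 2 / ehat) / rhat).

End APFIAL.

(* Main.v *)
Require Import Defs.
From HB Require Import structures.
From mathcomp Require Import all_boot all_order all_algebra.
From mathcomp Require Import all_classical all_reals all_analysis.
From mathcomp Require Import ring lra.
Import Order.TTheory GRing.Theory Num.Theory.
Import numFieldNormedType.Exports.
Local Open Scope classical_set_scope.
Local Open Scope ring_scope.

(** Every constant of the problem except the two tolerances is fixed, so both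
    claims follow from one estimate: the number of gradient evaluations is at
    most a constant times [(1 + ln (1 / (ehat * rhat))) / sqrt ehat]
    ([apf_sqrt_log_complexity]). The bound of the theorem is at least a
    constant multiple of this quantity: in its bracket the first summand is
    nonnegative, and the second one is [opnorm A / sqrt (ehat * mubar)]
    ([apf_bound_ge]).

    One call of R-FISTA. The augmented Lagrangian [f] is convex and has a
    Lipschitz gradient, and only the sum [phi = f + psi_n] is strongly convex.
    The vector [s_j] is an approximate subgradient of [phi] at [y_j]. Comparing
    [phi] at the midpoint of [y_j] and [x] turns the inequality for [s_j] into
    a quadratic lower model of curvature [mubar / 2], at the price of doubling
    the error ([approximate_subgradient_strong]). With these models, the
    quantity [A_j (phi y_j - phi x) + tau_j / 2 |x - x_j|^2] decreases along a
    cycle as long as the guess [mu] is at most [mubar]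
    ([estimate_sequence_step]). At [x = y_j] this yields the test of
    step (3), so restarts happen only while [mu > mubar], and the guess never
    falls below [mubar / 2]. Within a cycle [A_j] grows by a factor
    [1 + rho] with [rho] of order [sqrt (mubar / Lmax)] ([tr_A_growth]), and a
    passed test with a large residual bounds [A_j] ([continue_bound]); hence a
    call costs [O (sqrt (Lmax / mubar) * log)] evaluations.

    The outer loop. A Slater point and a bounded right inverse of [A] on its
    range keep the multipliers bounded by some [B] ([multiplier_bounded]), and
    [c_k (A z_k - b) = p_k - p_(k-1)]. So the constraint is met once
    [c_k >= 2 B / ehat], after which one more call suffices, and the penalties
    stay below a multiple of [1 / ehat]. The Lipschitz constant at iteration
    [k] is of order [c_k], and as the [c_k] grow geometrically the sum of the
    [sqrt c_k] is of the order of its last term, [1 / sqrt ehat].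

    The machines are nondeterministic, so both loops are handled by a
    real-valued potential that drops at each transition by at least one plus
    the number of evaluations ([rfista_progress], [apf_progress],
    [all_runs_reach_potential]). *)

(** * Executions controlled by a potential *)

(** The extra unit of decrease makes the potential a termination measure too:
    some transitions evaluate no gradient. *)
Lemma all_runs_reach_potential (R : realType) (S : Type)
    (step : S -> nat -> S -> Prop) (Q Inv : S -> Prop) (V : S -> R) :
  (forall s, Inv s -> 0 <= V s) ->
  (forall s, Inv s -> Q s \/
     (exists q s', step s q s') /\
     forall q s', step s q s' -> Inv s' /\ V s' + q%:R + 1 <= V s) ->
  forall s, Inv s -> exists2 N, all_runs_reach step Q s N & N%:R <= V s.
Proof.
move=> V0 Vstep s0 Inv0.
suff reach k : forall s n, Inv s -> V s < k%:R -> V s < n%:R + 1 ->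
    all_runs_reach step Q s n.
  exists (Num.truncn (V s0)); last by rewrite truncn_le V0.
  have lt1 : V s0 < (Num.truncn (V s0))%:R + 1 by rewrite natr1 truncnS_gt.
  by apply: (reach (Num.truncn (V s0)).+1) => //; rewrite truncnS_gt.
elim: k => [s n /V0 ? ?|k IH s n Is Vk Vn]; first by lra.
have [Qs|[ex all]] := Vstep _ Is; first exact: Reach_now.
have qn q s' : step s q s' -> (q <= n)%N.
  move=> /all[/V0 ? ?]; rewrite -ltnS -(ltr_nat R) -natr1; lra.
apply: Reach_later => // q s' st; have [Is' Vs'] := all _ _ st.
have q0 : 0 <= q%:R :> R by [].
apply: IH => //; first by move: Vk; rewrite -natr1; lra.
by rewrite natrB ?(qn _ s')//; lra.
Qed.

(** * Inner products *)
Section BilinearForm.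
Context {R : realType} {V : lmodType R}.
Variable B : V -> V -> R.
Hypothesis BC : forall u v, B u v = B v u.
Hypothesis BDl : forall u v w, B (u + v) w = B u w + B v w.
Hypothesis BZl : forall a u w, B (a *: u) w = a * B u w.
Hypothesis B0 : forall u, 0 <= B u u.

Lemma CauchySchwarz_sq u v : B u v ^+ 2 <= B u u * B v v.
Proof.
have key t : 0 <= B u u + 2 * t * B u v + t ^+ 2 * B v v.
  have := B0 (u + t *: v).
  by rewrite BDl BZl !(BC _ (u + _)) !BDl !BZl (BC v u); lra.
have [v0|v0] := eqVneq (B v v) 0.
  rewrite v0 mulr0; have [->|uv0] := eqVneq (B u v) 0; first by rewrite expr0n.
  have := key (- (B u u + 1) / (2 * B u v)).
  rewrite v0 mulr0 addr0 (_ : 2 * _ * _ = - (B u u + 1)); last by field.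
  lra.
have v1 : 0 < B v v by rewrite lt_neqAle eq_sym v0 B0.
have := key (- B u v / B v v).
rewrite (_ : _ + _ = (B u u * B v v - B u v ^+ 2) / B v v); last by field.
by rewrite pmulr_lge0 ?invr_gt0// subr_ge0.
Qed.

Lemma CauchySchwarz_sqrt u v : B u v <= Num.sqrt (B u u) * Num.sqrt (B v v).
Proof.
rewrite -sqrtrM//; apply: (le_trans (ler_norm _)).
by rewrite -sqrtr_sqr ler_wsqrtr// CauchySchwarz_sq.
Qed.

Lemma sqrt_form_triangle u v :
  Num.sqrt (B (u + v) (u + v)) <= Num.sqrt (B u u) + Num.sqrt (B v v).
Proof.
have h : 0 <= Num.sqrt (B u u) + Num.sqrt (B v v) by rewrite addr_ge0 ?sqrtr_ge0.
rewrite -(ler_pXn2r (n := 2)) ?nnegrE ?sqrtr_ge0// sqr_sqrtr//.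
rewrite sqrrD !sqr_sqrtr// BDl !(BC _ (u + v)) !BDl (BC v u).
have := CauchySchwarz_sqrt u v; lra.
Qed.

End BilinearForm.

Section EuclideanColumns.
Context {R : realType} {m : nat}.
Implicit Types u v w : 'cV[R]_m.

Lemma edotC u v : edot u v = edot v u.
Proof. by apply: eq_bigr => i _; rewrite mulrC. Qed.

Lemma edotDl u v w : edot (u + v) w = edot u w + edot v w.
Proof. by rewrite -big_split; apply: eq_bigr => i _; rewrite mxE mulrDl. Qed.

Lemma edotZl a u w : edot (a *: u) w = a * edot u w.
Proof. by rewrite mulr_sumr; apply: eq_bigr => i _; rewrite mxE mulrA. Qed.

Lemma edot_ge0 u : 0 <= edot u u.
Proof. by apply: sumr_ge0 => i _; rewrite -expr2 sqr_ge0. Qed.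

Lemma edotDr u v w : edot u (v + w) = edot u v + edot u w.
Proof. by rewrite edotC edotDl !(edotC u). Qed.

Lemma edotZr a u w : edot u (a *: w) = a * edot u w.
Proof. by rewrite edotC edotZl edotC. Qed.

Lemma edotNl u v : edot (- u) v = - edot u v.
Proof. by rewrite -scaleN1r edotZl mulN1r. Qed.

Lemma edotNr u v : edot u (- v) = - edot u v.
Proof. by rewrite edotC edotNl edotC. Qed.

Definition edot_lin := (edotDl, edotDr, edotZl, edotZr, edotNl, edotNr).

Lemma enorm_ge0 u : 0 <= enorm u. Proof. exact: sqrtr_ge0. Qed.

Lemma enorm_sq u : enorm u ^+ 2 = edot u u.
Proof. by rewrite sqr_sqrtr// edot_ge0. Qed.

Lemma edot_le u v : edot u v <= enorm u * enorm v.
Proof. exact: (CauchySchwarz_sqrt _ edotC edotDl edotZl edot_ge0). Qed.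

Lemma enormD u v : enorm (u + v) <= enorm u + enorm v.
Proof. exact: (sqrt_form_triangle _ edotC edotDl edotZl edot_ge0). Qed.

Lemma enormZ a u : enorm (a *: u) = `|a| * enorm u.
Proof.
by rewrite /enorm edotZl edotZr mulrA -expr2 sqrtrM ?sqr_ge0// sqrtr_sqr.
Qed.

Lemma enormN u : enorm (- u) = enorm u.
Proof. by rewrite -scaleN1r enormZ normrN normr1 mul1r. Qed.

Lemma coord_le_enorm u i : `|u i 0| <= enorm u.
Proof.
rewrite -sqrtr_sqr; apply: ler_wsqrtr; rewrite /edot (bigD1 i)//= -expr2.
by rewrite lerDl sumr_ge0// => j _; rewrite -expr2 sqr_ge0.
Qed.

Lemma enorm_gt0 u : u != 0 -> 0 < enorm u.
Proof.
move=> u0; rewrite lt_neqAle enorm_ge0 andbT eq_sym.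
apply: contraNneq u0 => nu; apply/eqP/matrixP => i j; rewrite ord1 mxE.
by apply/eqP; rewrite -normr_le0 -nu coord_le_enorm.
Qed.

End EuclideanColumns.

Section EuclideanSpace.
Context {R : realType} {E : normedModType R}.
Variable ip : {dot E for idfun}.
Hypothesis hE : is_euclidean ip.
Implicit Types u v w x y z : E.

Lemma ipC u v : ip u v = ip v u.
Proof. by rewrite (@hermitian_subproof R E false idfun ip u v) expr0 mul1r. Qed.

Lemma ipDl u v w : ip (u + v) w = ip u w + ip v w.
Proof. exact: linearDl. Qed.

Lemma ipDr u v w : ip u (v + w) = ip u v + ip u w.
Proof. exact: linearDr. Qed.

Lemma ipZl a u w : ip (a *: u) w = a * ip u w.
Proof. exact: linearZl_LR. Qed.

Lemma ipZr a u w : ip u (a *: w) = a * ip u w.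
Proof. by rewrite ipC ipZl ipC. Qed.

Lemma ipNl u v : ip (- u) v = - ip u v. Proof. exact: linearNl. Qed.
Lemma ipNr u v : ip u (- v) = - ip u v. Proof. exact: linearNr. Qed.
Lemma ip0l u : ip 0 u = 0. Proof. exact: linear0l. Qed.
Lemma ip0r u : ip u 0 = 0. Proof. exact: linear0r. Qed.

Lemma ip_sumr I (r : seq I) (P : pred I) (F : I -> E) u :
  ip u (\sum_(i <- r | P i) F i) = \sum_(i <- r | P i) ip u (F i).
Proof. exact: linear_sumr. Qed.

Definition ip_lin := (ipDl, ipDr, ipZl, ipZr, ipNl, ipNr, ip0l, ip0r).

Lemma ip_ge0 u : 0 <= ip u u.
Proof.
by have [->|/(neq0_dnorm_gt0 (s := ip))/ltW//] := eqVneq u 0; rewrite ip0l.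
Qed.

Lemma norm_sqE u : `|u| ^+ 2 = ip u u.
Proof. by rewrite hE.1 sqr_sqrtr// ip_ge0. Qed.

Lemma ip_le u v : ip u v <= `|u| * `|v|.
Proof.
by rewrite !hE.1; exact: (CauchySchwarz_sqrt _ ipC ipDl ipZl ip_ge0).
Qed.

Lemma ip_inj u v : (forall w, ip u w = ip v w) -> u = v.
Proof.
move=> uv; apply/eqP; rewrite -subr_eq0 -normr_eq0 -sqrf_eq0 norm_sqE.
by rewrite ipDl ipNl uv subrr.
Qed.

(** Induction on the spanning family. Given a representative [g] on the first
    [k] vectors, the component [ek - w] of the next vector orthogonal to them
    corrects [g] without disturbing its values on the previous ones. If that
    component vanishes, then [g] already represents [phi] on the next vector.
    The representative is kept in the span so that [w] can be obtained from
    the induction hypothesis, applied to [ip ek]. *)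
Lemma Riesz (phi : E -> R) :
  (forall u v, phi (u + v) = phi u + phi v) ->
  (forall a u, phi (a *: u) = a * phi u) -> exists g, forall v, phi v = ip g v.
Proof.
move=> phiD phiZ; have [n [e spane]] := hE.2.
have phi0 : phi 0 = 0 by rewrite -(scale0r (0 : E)) phiZ mul0r.
suff key k : (k <= n)%N -> forall f : E -> R,
    (forall u v, f (u + v) = f u + f v) ->
    (forall a u, f (a *: u) = a * f u) -> exists2 g,
    (forall i : 'I_n, (i < k)%N -> f (e i) = ip g (e i)) &
    exists c : 'I_n -> R, g = \sum_(i < n | (i < k)%N) c i *: e i.
  have [g ge _] := key n (leqnn n) phi phiD phiZ.
  exists g => v; have [c ->] := spane v.
  have -> : phi (\sum_i c i *: e i) = \sum_i c i * phi (e i).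
    elim/big_ind2 : _ => [|a b a' b' <- <-|i _]; [exact: phi0|exact: phiD|].
    exact: phiZ.
  by rewrite ip_sumr; apply: eq_bigr => i _; rewrite ipZr ge.
elim: k => [|k IH] kn f fD fZ.
  by exists 0 => //; exists (fun=> 0); rewrite big1.
have f0 : f 0 = 0 by rewrite -(scale0r (0 : E)) fZ mul0r.
have fsum (P : pred 'I_n) c :
    f (\sum_(i < n | P i) c i *: e i) = \sum_(i < n | P i) c i * f (e i).
  elim/big_ind2 : _ => [|a b a' b' <- <-|i _]; [exact: f0|exact: fD|exact: fZ].
have [g ge [c gc]] := IH (ltnW kn) f fD fZ; pose ek := e (Ordinal kn).
have ltS (i : 'I_n) : (i < k.+1)%N = (i < k)%N || (i == Ordinal kn).
  by rewrite ltnS leq_eqVlt orbC.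
have [w we [d wd]] := IH (ltnW kn) (ip ek) (ipDr ek) (ipZr^~ ek).
have orth d' : ip (ek - w) (\sum_(i < n | (i < k)%N) d' i *: e i) = 0.
  rewrite ip_sumr big1// => i ik.
  by rewrite ipZr ipDl ipNl we// subrr mulr0.
have ekw : ip (ek - w) ek = ip (ek - w) (ek - w).
  by rewrite [in RHS]ipDr ipNr (_ : ip (ek - w) w = 0) ?subr0// {2}wd orth.
have [u0|u0] := eqVneq (ek - w) 0.
  exists g; last first.
    exists (fun i : 'I_n => if (i < k)%N then c i else 0).
    rewrite gc big_mkcond [RHS]big_mkcond; apply: eq_bigr => i _; rewrite ltS.
    by case: (i < k)%N => //=; case: ifP; rewrite ?scale0r.
  move=> i; rewrite ltS => /orP[/ge//|/eqP->]; rewrite -/ek.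
  have -> : ek = w by apply/eqP; rewrite -subr_eq0 u0.
  rewrite wd fsum ip_sumr; apply: eq_bigr => j jk.
  by rewrite ipZr ge.
have upos : 0 < ip (ek - w) (ek - w) by exact: neq0_dnorm_gt0.
pose t := (f ek - ip g ek) / ip (ek - w) (ek - w).
exists (g + t *: (ek - w)).
  move=> i; rewrite ltS => /orP[ik|/eqP->]; rewrite ipDl ipZl.
    by rewrite ge// [ip (ek - w) _]ipDl ipNl we// subrr mulr0 addr0.
  by rewrite -/ek ekw divfK ?gt_eqF// addrC subrK.
exists (fun i : 'I_n => if i == Ordinal kn then t else c i - t * d i).
rewrite (bigD1 (Ordinal kn))/=; last by rewrite ltnSn.
rewrite eqxx -/ek (eq_bigl (fun i : 'I_n => (i < k)%N)); last first.
  move=> i; rewrite ltS; case: eqVneq => [->/=|]; last by rewrite orbF andbT.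
  by rewrite ltnn andbF.
rewrite scalerBr addrCA; congr (_ + _).
rewrite gc wd scaler_sumr -sumrB; apply: eq_bigr => i ik.
rewrite ifF; last by apply/eqP => iE; move: ik; rewrite iE ltnn.
by rewrite scalerBl scalerA.
Qed.

End EuclideanSpace.

(** * Gradients of smooth convex functions *)
Section SmoothConvex.
Context {R : realType} {E : normedModType R}.
Variable ip : {dot E for idfun}.
Hypothesis hE : is_euclidean ip.

Lemma grad_unique (f : E -> R) z g :
  (forall v, 'd (f : E -> R^o) z v = ip g v) -> grad ip f z = g.
Proof.
move=> dg; rewrite /grad; set G := [set g | _].
have : G (xget 0 G) by apply: xgetPex; exists g.
by move=> xG; apply: (ip_inj ip hE) => w; rewrite -dg -xG.
Qed.

Lemma gradE (f : E -> R) z v :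
  differentiable (f : E -> R^o) z -> 'd (f : E -> R^o) z v = ip (grad ip f z) v.
Proof.
move=> df; have [g dg] : exists g, forall v, 'd (f : E -> R^o) z v = ip g v.
  by apply: (Riesz ip hE) => *; rewrite ?linearD// linearZ.
by rewrite (grad_unique _ _ _ dg).
Qed.

(** Gradients of augmented Lagrangians are identified through this criterion:
    a quadratic remainder is available there without differentiating the
    penalty term. *)
Lemma grad_of_quadratic_remainder (f : E -> R) z g (k : R) :
  (forall v, `|f (z + v) - f z - ip g v| <= k * `|v| ^+ 2) ->
  grad ip f z = g.
Proof.
move=> hk; apply: grad_unique => v.
have lin : linear (ip g : E -> R^o).
  by move=> a u w; rewrite ipDr ipZr.
pose L := HB.pack_for {linear E -> R^o} (ip g : E -> R^o)
  (GRing.isLinear.Build _ _ _ _ _ lin).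
have -> : ip g v = L v by [].
suff -> : 'd (f : E -> R^o) z = L :> (E -> R^o) by [].
apply: diff_unique.
  apply/linear_bounded_continuous/ex_bound; exists `|g|.
  near=> u.
  have u1 : `|u| <= 1 by near: u; exact: nbhs0_le.
  rewrite /= ler_norml lerNl -ipNl !(le_trans (ip_le ip hE _ _))//.
    by rewrite ler_piMr.
  by rewrite normrN ler_piMr.
apply/eqaddoP => _/posnumP[e].
near=> h.
have -> : (f \o shift z - (cst (f z) + L)) h = f (z + h) - f z - ip g h.
  by rewrite /= opprD addrA (addrC z).
apply: (le_trans (hk h)).
have he : `|h| <= e%:num / (`|k| + 1).
  by near: h; apply: nbhs0_le; rewrite divr_gt0// ltr_wpDl.
rewrite expr2 mulrA ler_wpM2r//.
apply: (@le_trans _ _ (`|k| * (e%:num / (`|k| + 1)))).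
  by apply: (le_trans (ler_wpM2r _ (ler_norm k))) => //; rewrite ler_wpM2l.
rewrite mulrCA ger_pMr// ler_pdivrMr ?ltr_wpDl// mul1r; lra.
Unshelve. all: by end_near.
Qed.

Lemma convex_ge_linearization (f : E -> R) x y :
  convex_fun (fun z => (f z)%:E) -> differentiable (f : E -> R^o) x ->
  f x + ip (grad ip f x) (y - x) <= f y.
Proof.
move=> fc df; rewrite -gradE// -deriveE// -lerBrDl.
have dv : derivable (f : E -> R^o) x (y - x) by exact: diff_derivable.
rewrite /derive cvg_at_rightE//; apply: limr_le.
  move: dv => /cvg_ex[l dl]; apply/cvg_ex; exists l; apply: cvg_trans dl.
  apply: cvg_app => A FA.
  have : \forall u \near (0 : R)^', A u by exact: FA.
  suff : (\forall u \near (0 : R)^', A u) -> \forall u \near (0 : R)^'+, A u.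
    by [].
  rewrite !near_withinE; apply: filterS => u Au u0; apply: Au.
  by rewrite gt_eqF.
near=> t.
have t01 : 0 < t < 1.
  by apply/andP; split; near: t; [exact: nbhs_right_gt|exact: nbhs_right_lt].
have := fc y x t t01; rewrite -!EFinM -EFinD lee_fin.
have -> : t *: y + (1 - t) *: x = t *: (y - x) + x.
  by rewrite scalerBl scale1r scalerBr addrCA addrC.
move=> le; rewrite /= [_ *: _]mulrC ler_pdivrMr; last by case/andP: t01.
lra.
Unshelve. all: by end_near.
Qed.

(** The passage to the limit in the optimality condition of the proximal
    problem. *)
Lemma ge0_of_ge0_perturbed (a b : R) :
  (forall t, 0 < t < 1 -> 0 <= a + t * b) -> 0 <= a.
Proof.
move=> key; rewrite leNgt; apply/negP => a0.
have ab : 0 < `|b| - a by have := normr_ge0 b; lra.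
have t01 : 0 < - a / (2 * (`|b| - a)) < 1.
  rewrite divr_gt0 ?mulr_gt0//= ?oppr_gt0// ltr_pdivrMr ?mulr_gt0//.
  by have := normr_ge0 b; lra.
have := key _ t01; rewrite leNgt => /negP; apply.
have : - a / (2 * (`|b| - a)) * b <= - a / 2.
  rewrite mulrAC ler_pdivrMr ?mulr_gt0//.
  have -> : - a / 2 * (2 * (`|b| - a)) = - a * (`|b| - a) by field.
  by rewrite ler_wpM2l ?oppr_ge0 ?(ltW a0)//; have := ler_norm b; lra.
lra.
Qed.

End SmoothConvex.

(** * The proximal map *)
Section ProximalMap.
Context {R : realType} {E : normedModType R}.
Variable ip : {dot E for idfun}.
Hypothesis hE : is_euclidean ip.
Variables (h : E -> \bar R) (Mn : R).
Hypotheses (h_proper : proper_fun h) (h_convex : convex_fun h).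
Hypotheses (h_compact : compact (effdom h)).
Hypothesis h_lip : Mn.-lipschitz_(effdom h) (fun z => fine (h z) : R^o).

Local Notation D := (effdom h).
Local Notation hr := (fun z => fine (h z)).

Lemma effdom_fineK z : D z -> h z = (hr z)%:E.
Proof.
move=> Dz; rewrite fineK// fin_numE; apply/andP; split.
  by apply/eqP; exact: h_proper.1.
by rewrite -ltey.
Qed.

Lemma effdom_convex x y t : D x -> D y -> 0 < t < 1 ->
  D (t *: x + (1 - t) *: y) /\
  hr (t *: x + (1 - t) *: y) <= t * hr x + (1 - t) * hr y.
Proof.
move=> Dx Dy t01; have := h_convex x y t t01.
rewrite (effdom_fineK _ Dx) (effdom_fineK _ Dy) -!EFinM -EFinD => le.
have Dz : D (t *: x + (1 - t) *: y) by apply: (le_lt_trans le); rewrite ltry.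
by split => //; move: le; rewrite (effdom_fineK _ Dz) lee_fin.
Qed.

(** Outside the domain the subgradient inequality is trivial, so on the domain
    convex analysis of [h] reduces to that of the real function [fine \o h]. *)
Lemma subdiffP z g : D z ->
  subdiff ip h z g <-> forall u, D u -> hr z + ip g (u - z) <= hr u.
Proof.
move=> Dz; split => [zg u Du|zg u].
  by have := zg u; rewrite (effdom_fineK _ Dz) (effdom_fineK _ Du) -EFinD lee_fin.
have [Du|] := pselect (D u).
  by rewrite (effdom_fineK _ Dz) (effdom_fineK _ Du) -EFinD lee_fin zg.
by move=> /negP; rewrite /effdom/= -leNgt leye_eq => /eqP ->; rewrite leey.
Qed.

Lemma fine_lipschitz x y : D x -> D y -> `|hr x - hr y| <= Mn * `|x - y|.
Proof. by move=> Dx Dy; apply: (h_lip (x, y)). Qed.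

Lemma prox_exists lam x : 0 < lam -> exists2 y, D y & forall u, D u ->
  hr y + (2 * lam)^-1 * `|y - x| ^+ 2 <= hr u + (2 * lam)^-1 * `|u - x| ^+ 2.
Proof.
move=> l0.
pose F u : R^o := hr u + (2 * lam)^-1 * `|u - x| ^+ 2.
have cF : {within D, continuous F}.
  apply/subspace_continuousP => u Du; apply: cvgD.
    apply/cvgrPdist_le => e e0; rewrite near_withinE.
    near=> w => Dw; apply: (le_trans (fine_lipschitz _ _ Du Dw)).
    have uw : `|u - w| <= e / (`|Mn| + 1).
      by near: w; apply: cvgr_dist_le => //; rewrite divr_gt0// ltr_wpDl.
    apply: (@le_trans _ _ (`|Mn| * (e / (`|Mn| + 1)))).
      by apply: (le_trans (ler_wpM2r _ (ler_norm Mn))) => //; rewrite ler_wpM2l.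
    rewrite mulrCA ger_pMr// ler_pdivrMr ?ltr_wpDl// mul1r; lra.
  apply: cvg_within_filter; apply: cvgM; first exact: cvg_cst.
  rewrite expr2; under eq_fun do rewrite expr2.
  by apply: cvgM; apply: cvg_norm; apply: cvgB => //; exact: cvg_cst.
have [y yD yF] := compact_EVT_min h_proper.2 h_compact cF.
exists y; first exact: set_mem.
by move=> u Du; apply: yF; exact/mem_set.
Unshelve. all: by end_near.
Qed.

(** Optimality of [y] against [y + t (u - y)] gives, after division by [t], the
    subgradient inequality at [u] up to a term of order [t]. *)
Lemma proxP lam x (y := proxmap lam h x) : 0 < lam ->
  D y /\ subdiff ip h y (lam^-1 *: (x - y)).
Proof.
move=> l0; rewrite {}/y /proxmap; set P := [set y | _].
have [y0 Dy0 y0P] := prox_exists lam x l0.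
have : P (xget 0 P).
  apply: xgetPex; exists y0 => u.
  have [Du|] := pselect (D u).
    by rewrite (effdom_fineK _ Dy0) (effdom_fineK _ Du) -!EFinD lee_fin y0P.
  move=> /negP; rewrite /effdom/= -leNgt leye_eq => /eqP ->.
  by rewrite addye// leey.
set y := xget _ _ => yP.
have Dy : D y.
  have := yP y0; rewrite (effdom_fineK _ Dy0) -EFinD /effdom/= !ltey.
  by apply: contraTneq => ->; rewrite addye.
split=> //; apply/subdiffP => // u Du.
have key t : 0 < t < 1 ->
    0 <= hr u - hr y - ip (lam^-1 *: (x - y)) (u - y)
         + t * ((2 * lam)^-1 * `|u - y| ^+ 2).
  move=> t01; have [Dz hz] := effdom_convex u y t Du Dy t01.
  have := yP (t *: u + (1 - t) *: y).
  rewrite (effdom_fineK _ Dy) (effdom_fineK _ Dz) -!EFinD lee_fin.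
  move=> le; have := le_trans le (lerD hz (lexx _)).
  have -> : t *: u + (1 - t) *: y - x = (y - x) + t *: (u - y).
    by rewrite scalerBl scale1r addrCA addrAC scalerBr.
  have -> : lam^-1 *: (x - y) = - lam^-1 *: (y - x).
    by rewrite -opprB scalerN scaleNr.
  rewrite !(norm_sqE ip hE); move: (y - x) (u - y) => a b.
  rewrite !(ip_lin ip) (ipC ip b a) => le2.
  rewrite -(pmulr_rge0 _ (_ : 0 < t)); last by lra.
  have -> : lam^-1 = 2 * (2 * lam)^-1 by field; lra.
  lra.
rewrite -lerBrDl -subr_ge0; exact: ge0_of_ge0_perturbed key.
Qed.

End ProximalMap.

(** * One accelerated step *)
Section TrialScalars.
Context {R : realType} {E : normedModType R}.
Implicit Types (t : trial (R := R) (E := E)).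

(** [a_(j-1)] is the positive root of [L a^2 - tau a - tau A = 0]. *)
Lemma tr_a_quadratic t : 0 <= tr_A t -> 0 < tr_tau t -> 0 < tr_L t ->
  0 < tr_a t /\ tr_L t * tr_a t ^+ 2 = tr_tau t * tr_Anew t.
Proof.
move=> A0 tau0 L0.
have D0 : 0 <= tr_tau t ^+ 2 + 4 * tr_tau t * tr_A t * tr_L t.
  by rewrite addr_ge0 ?sqr_ge0// !mulr_ge0// ltW.
have := sqr_sqrtr D0; rewrite /tr_Anew /tr_a.
have := sqrtr_ge0 (tr_tau t ^+ 2 + 4 * tr_tau t * tr_A t * tr_L t).
set q := Num.sqrt _ => q0 q2; split; first by rewrite divr_gt0//; lra.
rewrite !mulrDr -[X in _ = X + _](_ : ((q ^+ 2 - tr_tau t ^+ 2) / (4 * tr_L t)) = _).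
  by field; lra.
by rewrite q2; field; lra.
Qed.

(** Linear convergence: [tau >= A mu / 2] turns the equation
    [L a^2 = tau (A + a)] into [a >= rho A]. *)
Lemma tr_A_growth t (mu rho : R) :
  0 <= tr_A t -> 0 < tr_L t -> 0 <= mu -> 0 <= rho ->
  tr_tau t = 1 + tr_A t * mu / 2 -> 2 * rho ^+ 2 * tr_L t <= mu ->
  (1 + rho) * tr_A t <= tr_Anew t.
Proof.
move=> A0 L0 mu0 rho0 tauE rhoE.
have tau1 : 1 <= tr_tau t by rewrite tauE lerDl divr_ge0// mulr_ge0.
have [a0 aE] := tr_a_quadratic t A0 (lt_le_trans ltr01 tau1) L0.
rewrite /tr_Anew mulrDl mul1r lerD2l.
have r0 : 0 <= rho * tr_A t by rewrite mulr_ge0.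
rewrite -(ler_pXn2r (n := 2)) ?nnegrE ?r0 ?(ltW a0)// -(ler_pM2l L0) aE.
apply: (@le_trans _ _ (tr_A t * mu / 2 * tr_A t)).
  rewrite exprMn mulrA [leRHS](_ : _ = mu / 2 * tr_A t ^+ 2); last by field.
  by apply: ler_wpM2r; [exact: sqr_ge0|rewrite ler_pdivlMr//; lra].
apply: ler_pM => //; first by rewrite divr_ge0// mulr_ge0.
  by rewrite tauE; lra.
by rewrite /tr_Anew; lra.
Qed.

Lemma tr_a_first t : tr_A t = 0 -> tr_tau t = 1 -> 0 < tr_L t ->
  tr_Anew t = (tr_L t)^-1.
Proof.
move=> A0 tau1 L0; have [||//|a0 aE] := tr_a_quadratic t; rewrite ?A0 ?tau1//.
move: aE; rewrite /tr_Anew A0 tau1 add0r mul1r => aE.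
apply: (mulfI (lt0r_neq0 L0)); rewrite mulfV ?gt_eqF//.
by apply: (mulIf (lt0r_neq0 a0)); rewrite mul1r -mulrA -expr2.
Qed.

Lemma tr_taunewE t mu : tr_tau t = 1 + tr_A t * mu / 2 ->
  tr_taunew mu t = 1 + tr_Anew t * mu / 2.
Proof. by move=> tauE; rewrite /tr_taunew tauE /tr_Anew; field. Qed.

End TrialScalars.

Section AcceleratedStep.
Context {R : realType} {E : normedModType R}.
Variable ip : {dot E for idfun}.
Hypothesis hE : is_euclidean ip.

(** The algebra of the accelerated step with the origin at [y_j]: [u], [p], [w]
    and [z] stand for [x], [x_(j-1)], [y_(j-1)] and [x_j]. Both sides are
    quadratic in [u] with the same leading coefficient, and the linear terms
    agree by the choice of [z]; what remains is
    [|tau p - a s|^2 / (tau + a mu / 2) <= |tau p - a s|^2 / tau]. *)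
Lemma accelerated_step_inequality (s u p w z : E) (A a tau mu L : R) :
  0 <= A -> 0 < a -> 0 < tau -> 0 <= mu -> 0 < L ->
  L * a ^+ 2 = tau * (A + a) ->
  (tau + a * mu / 2) *: z = tau *: p - a *: s ->
  (A + a) *: s = L *: (A *: w + a *: p) ->
  (A + a) / (2 * L) * ip s s + (tau + a * mu / 2) / 2 * ip (u - z) (u - z)
  <= A * ip s w + a * ip s u + a * mu / 4 * ip u u
     + tau / 2 * ip (u - p) (u - p).
Proof.
move=> A0 a0 tau0 mu0 L0 aE zE sE.
have tau'0 : 0 < tau + a * mu / 2.
  by rewrite ltr_pwDl// divr_ge0// mulr_ge0// ltW.
have sw : A * ip s w = (A + a) / L * ip s s - a * ip s p.
  have := congr1 (ip s) sE; rewrite !(ip_lin ip) => e.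
  apply: (mulfI (lt0r_neq0 L0)); rewrite mulrBr mulrA.
  rewrite (_ : L * ((A + a) / L * _) = (A + a) * ip s s); last by field; lra.
  by rewrite e; ring.
have uz : (tau + a * mu / 2) * ip u z = tau * ip u p - a * ip s u.
  by rewrite -(ipZr ip) zE !(ip_lin ip) (ipC ip u s).
have zz : (tau + a * mu / 2) * ip z z <=
    tau * ip p p - 2 * a * ip s p + (A + a) / L * ip s s.
  pose Q := tau ^+ 2 * ip p p - 2 * tau * a * ip s p + a ^+ 2 * ip s s.
  have QE : ip (tau *: p - a *: s) (tau *: p - a *: s) = Q.
    by rewrite !(ip_lin ip) (ipC ip p s) /Q; ring.
  have Q0 : 0 <= Q by rewrite -QE ip_ge0.
  have zQ : (tau + a * mu / 2) * ((tau + a * mu / 2) * ip z z) = Q.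
    by rewrite -QE -zE !(ip_lin ip).
  rewrite -(ler_pM2l tau'0) zQ.
  have -> : (A + a) / L = a ^+ 2 / tau.
    apply/eqP; rewrite eqr_div ?lt0r_neq0//; apply/eqP.
    by rewrite mulrC -aE mulrC.
  rewrite -subr_ge0.
  have -> : (tau + a * mu / 2) * (tau * ip p p - 2 * a * ip s p +
      a ^+ 2 / tau * ip s s) - Q = (a * mu / 2) / tau * Q.
    by rewrite /Q; field; lra.
  by rewrite mulr_ge0// divr_ge0// ?mulr_ge0 ?(ltW tau0) ?(ltW a0).
have sqB x y : ip (x - y) (x - y) = ip x x - 2 * ip x y + ip y y.
  by rewrite !(ip_lin ip) (ipC ip y x); ring.
rewrite sw !sqB.
have -> : (A + a) / (2 * L) = (A + a) / L / 2 by field; lra.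
set k := (A + a) / L in zz *; lra.
Qed.

End AcceleratedStep.

(** * Complexity of one call of R-FISTA *)
Section RFistaComplexity.
Context {R : realType} {E : normedModType R}.
Variable ip : {dot E for idfun}.
Hypothesis hE : is_euclidean ip.
Variables (f : E -> R) (h : E -> \bar R).
Variables (chi Mbar0 eps : R) (xbar0 : E).
Variables (Lf Mn mubar Dm Lmax Amax rho : R).
Local Notation G := (grad ip f).
Local Notation D := (effdom h).
Local Notation phi := (fun z => f z + fine (h z)).
Local Notation ynew := (tr_ynew ip f h).
Local Notation snew := (tr_s ip f h).
Local Notation vnew := (tr_v ip f h).

(** [Lmax] dominates all curvature estimates [L_j], [Amax] dominates the [A_j]
    of the iterations that do not stop, and [rho] is a rate at which the [A_j]
    are sure to grow. They are parameters, since the outer loop takes the same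
    [Amax] in all its calls. *)
Hypotheses (chi01 : 0 < chi < 1) (Mbar0_gt0 : 0 < Mbar0) (eps_gt0 : 0 < eps).
Hypotheses (Lf_ge0 : 0 <= Lf) (mubar_gt0 : 0 < mubar) (rho_gt0 : 0 < rho).
Hypothesis f_lower : forall x v, f x + ip (G x) (v - x) <= f v.
Hypothesis f_upper :
  forall x v, f v <= f x + ip (G x) (v - x) + Lf * `|v - x| ^+ 2.
Hypothesis f_lip : forall x v, `|G x - G v| <= Lf * `|x - v|.
Hypotheses (h_proper : proper_fun h) (h_convex : convex_fun h).
Hypotheses (h_compact : compact (effdom h)).
Hypothesis h_lip : Mn.-lipschitz_(effdom h) (fun z => fine (h z) : R^o).
Hypothesis phi_midpoint : forall x y, D x -> D y ->
  phi (2^-1 *: x + 2^-1 *: y) <=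
  (phi x + phi y) / 2 - mubar / 8 * `|x - y| ^+ 2.
Hypothesis D_bounded : forall x y, D x -> D y -> `|x - y| <= Dm.
Hypothesis D_xbar0 : D xbar0.
Hypothesis LmaxE : Mbar0 + 8 * Lf / (1 - chi) <= Lmax.
Hypothesis AmaxE : 4 * Lmax ^+ 2 * Dm ^+ 2 <= Amax * (chi * Mbar0 * eps ^+ 2).
Hypothesis Amax1 : 1 <= Amax * Mbar0.
Hypothesis rhoE : 4 * rho ^+ 2 * Lmax <= mubar.

Let effdom_mid x y : D x -> D y -> D (2^-1 *: x + 2^-1 *: y).
Proof.
move=> Dx Dy; have half : 0 < (2^-1 : R) < 1 by lra.
have [+ _] := effdom_convex h h_proper h_convex x y 2^-1 Dx Dy half.
by rewrite (_ : 1 - 2^-1 = 2^-1 :> R)//; field.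
Qed.

(** Evaluate the approximate subgradient inequality at the midpoint of [x] and
    [y] and bound [phi] there by strong convexity. Going from the half step
    back to the full one doubles the error [d], and half of the strong
    convexity constant survives. *)
Lemma approximate_subgradient_strong y s d x : D y -> D x ->
  (forall u, D u -> phi y + ip s (u - y) - d <= phi u) ->
  phi y + ip s (x - y) - 2 * d + mubar / 4 * `|x - y| ^+ 2 <= phi x.
Proof.
move=> Dy Dx sub; have := sub _ (effdom_mid x y Dx Dy).
have := phi_midpoint x y Dx Dy.
have -> : 2^-1 *: x + 2^-1 *: y - y = 2^-1 *: (x - y).
  rewrite scalerBr -addrA; congr (_ + _).
  rewrite -[X in _ - X]scale1r -scalerBl -scaleNr; congr (_ *: _).
  by field.
by rewrite (ipZr ip) /=; lra.
Qed.

Lemma trial_subgradient t : 0 < tr_L t ->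
  D (ynew t) /\ subdiff ip h (ynew t) (snew t - G (tr_xt t)).
Proof.
move=> L0; have Li : 0 < (tr_L t)^-1 by rewrite invr_gt0.
have [Dy] := proxP ip hE h Mn h_proper h_convex h_compact h_lip _
  (tr_xt t - (tr_L t)^-1 *: G (tr_xt t)) Li.
rewrite invrK addrAC scalerBr scalerA mulfV ?gt_eqF// scale1r.
by [].
Qed.

Lemma trial_residual t : 0 < tr_L t ->
  D (ynew t) /\ exists2 g, subdiff ip h (ynew t) g & vnew t = G (ynew t) + g.
Proof.
move=> L0; have [Dy sy] := trial_subgradient t L0; split=> //.
by exists (snew t - G (tr_xt t)); rewrite // /tr_v -addrA [- _ + _]addrC.
Qed.

Lemma trial_residual_le t : 0 < tr_L t ->
  `|vnew t| <= (Lf + tr_L t) * `|ynew t - tr_xt t|.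
Proof.
move=> L0; apply: (le_trans (ler_normD _ _)); rewrite mulrDl lerD ?f_lip//.
by rewrite /tr_s normrZ gtr0_norm// distrC.
Qed.

(** The error of [s] as a subgradient of [phi] is the linearization error of
    [f] at [ynew t], which an accepted trial bounds by
    [(1 - chi) L / 4 |y - x~|^2]. *)
Lemma trial_lower_model t x : 0 < tr_L t -> D x ->
  ~ tr_backtrack ip f h chi t ->
  phi (ynew t) + ip (snew t) (x - ynew t)
   - 2 * ((1 - chi) * tr_L t / 4 * `|ynew t - tr_xt t| ^+ 2)
   + mubar / 4 * `|x - ynew t| ^+ 2 <= phi x.
Proof.
move=> L0 Dx /negP; rewrite /tr_backtrack -leNgt /linearize => nb.
have [Dy sy] := trial_subgradient t L0.
apply: approximate_subgradient_strong => // u Du.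
have hu := (subdiffP ip h h_proper _ _ Dy).1 sy u Du.
have fu := f_lower (tr_xt t) u.
move: nb fu hu; have -> : u - tr_xt t = (u - ynew t) + (ynew t - tr_xt t).
  by rewrite addrA subrK.
by rewrite !(ip_lin ip) /=; lra.
Qed.

(** The estimate sequence inequality is the convex combination, with weights
    [tr_A t] and [tr_a t], of the lower models at [tr_y t] and at [x]. Per unit
    of weight, the algebraic identity provides a gain of [L / 2 |y - x~|^2],
    of which the model errors consume the fraction [1 - chi]. *)
Lemma estimate_sequence_step mu t x : 0 <= mu <= mubar ->
  0 <= tr_A t -> 0 < tr_tau t -> 0 < tr_L t -> D (tr_y t) -> D x ->
  ~ tr_backtrack ip f h chi t ->
  tr_Anew t * (phi (ynew t) - phi x)
   + tr_taunew mu t / 2 * `|x - tr_xnew ip f h mu t| ^+ 2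
   + chi * tr_Anew t * tr_L t / 2 * `|ynew t - tr_xt t| ^+ 2
  <= tr_A t * (phi (tr_y t) - phi x) + tr_tau t / 2 * `|x - tr_x t| ^+ 2.
Proof.
move=> /andP[mu0 mub] A0 tau0 L0 Dyt Dx nb.
have mx := trial_lower_model t x L0 Dx nb.
have my := trial_lower_model t (tr_y t) L0 Dyt nb.
have [a0 aE] := tr_a_quadratic t A0 tau0 L0.
have tau'0 : 0 < tr_taunew mu t.
  by rewrite /tr_taunew ltr_pwDl// divr_ge0// mulr_ge0// ltW.
have An0 : 0 < tr_Anew t by rewrite /tr_Anew ltr_wpDl.
have key := accelerated_step_inequality ip (snew t) (x - ynew t)
  (tr_x t - ynew t) (tr_y t - ynew t) (tr_xnew ip f h mu t - ynew t)
  (tr_A t) (tr_a t) (tr_tau t) mu (tr_L t) A0 a0 tau0 mu0 L0 aE.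
have zE : (tr_tau t + tr_a t * mu / 2) *: (tr_xnew ip f h mu t - ynew t) =
    tr_tau t *: (tr_x t - ynew t) - tr_a t *: snew t.
  rewrite scalerBr /tr_xnew /tr_taunew scalerA mulfV ?scale1r; last first.
    by rewrite gt_eqF.
  rewrite scalerDl scalerBr (mulrC mu) -[X in X - _ = _]addrA.
  by rewrite [X in X - _]addrC [X in _ - X]addrC addrKA addrAC.
have sE : (tr_A t + tr_a t) *: snew t = tr_L t *:
    (tr_A t *: (tr_y t - ynew t) + tr_a t *: (tr_x t - ynew t)).
  rewrite /tr_s scalerA mulrC -scalerA; congr (_ *: _).
  rewrite scalerBr /tr_xt scalerA mulfV ?scale1r; last by rewrite gt_eqF.
  by rewrite scalerDl opprD addrACA !scalerBr.
move: key => /(_ zE sE).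
have xu : x - ynew t - (tr_xnew ip f h mu t - ynew t) = x - tr_xnew ip f h mu t.
  by rewrite opprB addrA subrK.
have xp : x - ynew t - (tr_x t - ynew t) = x - tr_x t.
  by rewrite opprB addrA subrK.
rewrite xu xp -!(norm_sqE ip hE).
have sn : `|snew t| ^+ 2 = tr_L t ^+ 2 * `|ynew t - tr_xt t| ^+ 2.
  by rewrite /tr_s normrZ exprMn gtr0_norm// distrC.
rewrite sn -/(tr_taunew mu t) -/(tr_Anew t).
have -> : tr_Anew t / (2 * tr_L t) *
    (tr_L t ^+ 2 * `|ynew t - tr_xt t| ^+ 2)
  = tr_Anew t * tr_L t / 2 * `|ynew t - tr_xt t| ^+ 2 by field; lra.
move=> key.
have mxm : phi (ynew t) + ip (snew t) (x - ynew t)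
   - (1 - chi) * tr_L t / 2 * `|ynew t - tr_xt t| ^+ 2
   + mu / 4 * `|x - ynew t| ^+ 2 <= phi x.
  have : mu / 4 * `|x - ynew t| ^+ 2 <= mubar / 4 * `|x - ynew t| ^+ 2.
    by apply: ler_wpM2r; [exact: sqr_ge0|lra].
  by move: mx => /=; lra.
have mym : phi (ynew t) + ip (snew t) (tr_y t - ynew t)
   - (1 - chi) * tr_L t / 2 * `|ynew t - tr_xt t| ^+ 2 <= phi (tr_y t).
  have : 0 <= mubar / 4 * `|tr_y t - ynew t| ^+ 2.
    by rewrite mulr_ge0 ?sqr_ge0// divr_ge0// ltW.
  by move: my => /=; lra.
have mxa := ler_wpM2l (ltW a0) mxm.
have myA := ler_wpM2l A0 mym.
move: key mxa myA; rewrite /tr_taunew /tr_Anew /=; lra.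
Qed.

(** At [x = y_j] the function values cancel from the estimate sequence
    inequality, and what remains implies the test of step (3). So a failed test
    reveals [mu > mubar]. *)
Lemma accepted_check mu t x0 : 0 <= mu <= mubar ->
  0 <= tr_A t -> 0 < tr_tau t -> 0 < tr_L t -> D (tr_y t) ->
  (forall x, D x -> tr_A t * (phi (tr_y t) - phi x)
     + tr_tau t / 2 * `|x - tr_x t| ^+ 2 <= `|x - x0| ^+ 2 / 2) ->
  ~ tr_backtrack ip f h chi t -> tr_check ip f h chi x0 t.
Proof.
move=> mub A0 tau0 L0 Dyt inv nb.
have [Dy _] := trial_subgradient t L0.
have := estimate_sequence_step mu t _ mub A0 tau0 L0 Dyt Dy nb.
have := inv _ Dy; rewrite subrr mulr0 add0r /tr_check => i1 i2.
have : 0 <= tr_taunew mu t / 2 * `|ynew t - tr_xnew ip f h mu t| ^+ 2.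
  rewrite mulr_ge0 ?sqr_ge0// divr_ge0// /tr_taunew addr_ge0 ?(ltW tau0)//.
  have [a0 _] := tr_a_quadratic t A0 tau0 L0.
  by rewrite divr_ge0// mulr_ge0 ?(ltW a0)//; case/andP: mub.
lra.
Qed.

(** By [f_upper], a rejected trial has [(1 - chi) L / 4 < Lf]. *)
Lemma backtrack_bound t : 0 < tr_L t -> tr_backtrack ip f h chi t ->
  2 * tr_L t <= Lmax.
Proof.
move=> L0; rewrite /tr_backtrack /linearize => bt.
have fu := f_upper (tr_xt t) (ynew t).
have : (1 - chi) * tr_L t / 4 * `|ynew t - tr_xt t| ^+ 2
   < Lf * `|ynew t - tr_xt t| ^+ 2 by lra.
have := sqr_ge0 `|ynew t - tr_xt t|; rewrite le_eqVlt => /predU1P[<-|d0].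
  by rewrite !mulr0 ltxx.
rewrite ltr_pM2r// => lt.
have chi1 : 0 < 1 - chi by rewrite subr_gt0; case/andP: chi01.
have : tr_L t <= 4 * Lf / (1 - chi) by rewrite ler_pdivlMr//; lra.
by have := LmaxE; have := Mbar0_gt0; lra.
Qed.

(** The residual is at most [2 Lmax |y - x~|], while the passed test bounds
    [A_j L_j |y - x~|^2] by the squared diameter. A residual above [eps]
    therefore caps [A_j]. *)
Lemma continue_bound t x0 : D x0 -> Mbar0 <= tr_L t <= Lmax ->
  0 <= tr_Anew t ->
  tr_check ip f h chi x0 t -> eps < `|vnew t| -> tr_Anew t < Amax.
Proof.
move=> Dx0 /andP[LM Lm] A0 ck ev.
have L0 : 0 < tr_L t by exact: lt_le_trans LM.
have [Dy _] := trial_subgradient t L0.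
have Lm0 : 0 < Lmax by exact: lt_le_trans Lm.
have LfLm : Lf <= Lmax.
  apply: le_trans LmaxE; have chi1 : 0 < 1 - chi by rewrite subr_gt0; case/andP: chi01.
  have : 8 * Lf <= 8 * Lf / (1 - chi).
    rewrite ler_pdivlMr// ler_piMr ?mulr_ge0// lerBlDr lerDl.
    by case/andP: chi01 => /ltW.
  by have := Mbar0_gt0; have := Lf_ge0; lra.
have d2 := trial_residual_le t L0.
set d := `|ynew t - tr_xt t| in d2 ck *.
have d0 : 0 <= d by exact: normr_ge0.
have e1 : eps < 2 * Lmax * d.
  apply: (lt_le_trans ev); apply: (le_trans d2); rewrite ler_wpM2r//; lra.
have e2 : eps ^+ 2 < 4 * Lmax ^+ 2 * d ^+ 2.
  have -> : 4 * Lmax ^+ 2 * d ^+ 2 = (2 * Lmax * d) ^+ 2 by ring.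
  by rewrite ltr_pXn2r// ?nnegrE ?(ltW eps_gt0)// !mulr_ge0// ltW.
have ck2 : chi * tr_Anew t * Mbar0 * d ^+ 2 <= Dm ^+ 2.
  apply: (@le_trans _ _ (`|ynew t - x0| ^+ 2)); last first.
    by rewrite ler_pXn2r// ?nnegrE ?D_bounded// (le_trans _ (D_bounded _ _ Dy Dx0)).
  apply: le_trans ck; rewrite ler_wpM2r ?sqr_ge0// ler_wpM2l//.
  by rewrite mulr_ge0// ltW//; case/andP: chi01.
rewrite ltNge; apply/negP => AmA.
have cM : 0 < chi * Mbar0 by rewrite mulr_gt0//; case/andP: chi01.
have Am0 : 0 < Amax.
  rewrite ltNge; apply/negP => Am0; have : Amax * Mbar0 <= 0.
    by rewrite mulr_le0_ge0// ltW.
  by move: Amax1; lra.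
have h1 : Amax * (chi * Mbar0 * eps ^+ 2) <
    Amax * (chi * Mbar0) * (4 * Lmax ^+ 2 * d ^+ 2).
  by rewrite -(mulrA Amax) ltr_pM2l// ltr_pM2l.
have h2 : Amax * (chi * Mbar0) * d ^+ 2 <= Dm ^+ 2.
  apply: le_trans ck2; rewrite ler_wpM2r ?sqr_ge0//.
  have -> : chi * tr_Anew t * Mbar0 = tr_Anew t * (chi * Mbar0) by ring.
  by rewrite ler_wpM2r// ltW.
have h3 : 4 * Lmax ^+ 2 * (Amax * (chi * Mbar0) * d ^+ 2) <= 4 * Lmax ^+ 2 * Dm ^+ 2.
  by rewrite ler_wpM2l// mulr_ge0 ?sqr_ge0.
move: AmaxE h1 h2 h3; lra.
Qed.


Definition rfista_inv (st : rfista_state (R := R) (E := E)) : Prop :=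
  match st with
  | NewCycle l M mu => Mbar0 <= M <= Lmax /\ mubar / 2 <= mu
  | Search l mu x0 t =>
    [/\ mubar / 2 <= mu, D x0, D (tr_y t), Mbar0 <= tr_L t <= Lmax
      & tr_tau t = 1 + tr_A t * mu / 2] /\
    (tr_A t = 0 \/ Lmax^-1 <= tr_A t < Amax) /\
    (mu <= mubar -> forall x, D x -> tr_A t * (phi (tr_y t) - phi x)
       + tr_tau t / 2 * `|x - tr_x t| ^+ 2 <= `|x - x0| ^+ 2 / 2)
  | Output y v =>
    [/\ D y, exists2 g, subdiff ip h y g & v = G y + g & `|v| <= eps]
  end.

(** [A] is multiplied by at least [1 + rho] at each iteration and stays below
    [Amax]. The first iteration, where [A = 0], produces some [A >= Lmax^-1]. *)
Definition iterations_left (A : R) : R :=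
  if A == 0 then 2 + ln (Amax * Lmax) / ln (1 + rho)
  else 1 + ln (Amax / A) / ln (1 + rho).

Definition doublings_left (L : R) : R := 1 + ln (Lmax / L) / ln 2.

(** The guess is halved at each restart and never gets below [mubar / 2]. *)
Definition cycles_left (mu : R) : R := ln (2 * mu / mubar) / ln 2.

Definition cycle_length : R :=
  1 + iterations_left 0 + doublings_left Mbar0.

(** The factor 3 pays for the two evaluations of an accepted trial and for the
    unit of decrease. Each remaining cycle carries the cost of a fresh one. *)
Definition rfista_potential (st : rfista_state (R := R) (E := E)) : R :=
  match st with
  | NewCycle l M mu => 3 * cycle_length * (1 + cycles_left mu)
  | Search l mu x0 t =>
    3 * (iterations_left (tr_A t) + doublings_left (tr_L t))
    + 3 * cycle_length * cycles_left mu
  | Output y v => 0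
  end.

Let ln2_gt0 : 0 < ln 2 :> R. Proof. by rewrite ln_gt0// ltr1n. Qed.

Let lnrho_gt0 : 0 < ln (1 + rho).
Proof. by rewrite ln_gt0// ltrDl. Qed.

Let Lmax_gt0 : 0 < Lmax.
Proof.
apply: lt_le_trans Mbar0_gt0 _; apply: le_trans LmaxE.
rewrite lerDl divr_ge0 ?mulr_ge0// subr_ge0 ltW//; by case/andP: chi01.
Qed.

Let Mbar0_le_Lmax : Mbar0 <= Lmax.
Proof.
apply: le_trans LmaxE.
rewrite lerDl divr_ge0 ?mulr_ge0// subr_ge0 ltW//; by case/andP: chi01.
Qed.

Let Amax_gt0 : 0 < Amax.
Proof.
have := lt_le_trans ltr01 Amax1.
by rewrite pmulr_lgt0.
Qed.

Let AL_ge1 : 1 <= Amax * Lmax.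
Proof. by apply: le_trans Amax1 _; rewrite ler_pM2l. Qed.

Let iterations0_ge2 : 2 <= iterations_left 0.
Proof.
by rewrite /iterations_left eqxx lerDl divr_ge0 ?(ltW lnrho_gt0)// ln_ge0.
Qed.

Let AmaxD A : Lmax^-1 <= A < Amax ->
  [/\ 0 < A, 1 <= Amax / A & Amax / A <= Amax * Lmax].
Proof.
move=> /andP[LA AA]; have A0 : 0 < A.
  by apply: lt_le_trans LA; rewrite invr_gt0.
split=> //; first by rewrite ler_pdivlMr// mul1r ltW.
by rewrite ler_pM2l// -[leRHS]invrK lef_pV2 ?posrE ?invr_gt0.
Qed.

Lemma iterations_left_ge1 A :
  A = 0 \/ Lmax^-1 <= A < Amax -> 1 <= iterations_left A.
Proof.
move=> [->|/AmaxD[A0 A1 _]]; first by rewrite (le_trans _ iterations0_ge2)// ler1n.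
by rewrite /iterations_left gt_eqF// lerDl divr_ge0 ?(ltW lnrho_gt0)// ln_ge0.
Qed.

Lemma iterations_left_next A A' : A = 0 \/ Lmax^-1 <= A < Amax ->
  Lmax^-1 <= A' < Amax -> (1 + rho) * A <= A' ->
  iterations_left A' + 1 <= iterations_left A.
Proof.
move=> [->|AA] AA' le; have [A'0 A'1 A'2] := AmaxD _ AA'.
  rewrite /iterations_left gt_eqF// eqxx.
  have : ln (Amax / A') / ln (1 + rho) <= ln (Amax * Lmax) / ln (1 + rho).
    rewrite ler_pM2r ?invr_gt0// ler_ln// posrE; first by rewrite divr_gt0.
    by rewrite mulr_gt0.
  lra.
have [A0 A1 _] := AmaxD _ AA; rewrite /iterations_left !gt_eqF//.
have r1 : 0 < 1 + rho by rewrite ltr_wpDl.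
have : ln (Amax / A') + ln (1 + rho) <= ln (Amax / A).
  rewrite -lnM ?posrE ?divr_gt0// ler_ln ?posrE ?mulr_gt0 ?invr_gt0//.
  by rewrite ler_pdivlMr// -(mulrA (_ / _)) mulrAC ler_pdivrMr// ler_pM2l.
rewrite -(ler_pM2r (_ : 0 < (ln (1 + rho))^-1)) ?invr_gt0// mulrDl.
rewrite mulfV ?gt_eqF//; lra.
Qed.

Lemma doublings_left_ge1 L : 0 < L <= Lmax -> 1 <= doublings_left L.
Proof.
move=> /andP[L0 LL]; rewrite lerDl divr_ge0 ?(ltW ln2_gt0)// ln_ge0//.
by rewrite ler_pdivlMr// mul1r.
Qed.

Lemma doublings_left_le L : Mbar0 <= L -> doublings_left L <= doublings_left Mbar0.
Proof.
move=> ML; have L0 : 0 < L by exact: lt_le_trans ML.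
rewrite lerD2l ler_pM2r ?invr_gt0// ler_ln ?posrE ?divr_gt0//.
by rewrite ler_pM2l// lef_pV2.
Qed.

Lemma doublings_left_double L : 0 < L ->
  doublings_left (2 * L) + 1 = doublings_left L.
Proof.
move=> L0; rewrite /doublings_left [in RHS](_ : Lmax / L = 2 * (Lmax / (2 * L))).
  by rewrite [in RHS]lnM ?posrE ?divr_gt0 ?mulr_gt0//; field; rewrite gt_eqF.
by field; rewrite gt_eqF.
Qed.

Lemma cycles_left_ge0 mu : mubar / 2 <= mu -> 0 <= cycles_left mu.
Proof.
move=> mm; rewrite divr_ge0 ?(ltW ln2_gt0)// ln_ge0//.
by rewrite ler_pdivlMr//; lra.
Qed.

Lemma cycles_left_half mu : 0 < mu -> cycles_left (mu / 2) + 1 = cycles_left mu.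
Proof.
move=> mu0; rewrite /cycles_left.
rewrite [in RHS](_ : 2 * mu / mubar = 2 * (2 * (mu / 2) / mubar)); last first.
  by field; rewrite gt_eqF.
rewrite [in RHS]lnM ?posrE ?divr_gt0 ?mulr_gt0 ?divr_gt0//.
by field; rewrite gt_eqF.
Qed.

Lemma cycle_length_ge0 : 0 <= cycle_length.
Proof.
have : 1 <= doublings_left Mbar0.
  by rewrite doublings_left_ge1// Mbar0_gt0 Mbar0_le_Lmax.
by rewrite /cycle_length; have := iterations0_ge2; lra.
Qed.

Lemma rfista_potential_ge0 st : rfista_inv st -> 0 <= rfista_potential st.
Proof.
case: st => [l M mu|l mu x0 t|y v] //=.
  move=> [_ mm]; apply: mulr_ge0; first by rewrite mulr_ge0// cycle_length_ge0.
  by rewrite addr_ge0// cycles_left_ge0.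
move=> [[mm _ _ /andP[LM LL] _] [At _]].
have L0 : 0 < tr_L t by exact: lt_le_trans LM.
have := iterations_left_ge1 _ At.
have := doublings_left_ge1 (tr_L t); rewrite L0 LL => /(_ isT).
have : 0 <= 3 * cycle_length * cycles_left mu.
  by apply: mulr_ge0; [rewrite mulr_ge0// cycle_length_ge0|exact: cycles_left_ge0].
lra.
Qed.

(** Backtracking uses up a doubling, a continued iteration uses up a growth
    step of [A], and a restart, possible only when [mu > mubar], uses up a
    cycle. *)
Lemma rfista_progress st : rfista_inv st ->
  (exists y v, st = Output y v) \/
  ((exists q s', rfista_step ip f h chi Mbar0 eps xbar0 st q s') /\
   forall q s', rfista_step ip f h chi Mbar0 eps xbar0 st q s' ->
     rfista_inv s' /\
     rfista_potential s' + q%:R + 1 <= rfista_potential st).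
Proof.
case: st => [l M mu|l mu x0 t|y v] /=; last by left; exists y, v.
  move=> [/andP[M1 M2] mm]; right; split.
    exists 0%N, (Search l mu xbar0 (Trial 0 1 M xbar0 xbar0)).
    apply: Step_init => //; rewrite lexx andbT ge_max M1 andbT.
    rewrite ler_pdivrMr//; have : 0 < M by exact: lt_le_trans M1.
    lra.
  move=> q s' st; inversion st as [l' M' mu' Mlow x0 Ml Dx0 _| | | |]; subst.
  move: Ml => /andP[]; rewrite ge_max => /andP[_ Ml1] Ml2 /=; split.
    split; first by split; rewrite ?mul0r ?addr0// Ml1 (le_trans Ml2).
    split; first by left.
    move=> _ x Dx; rewrite mul0r add0r; lra.
  have := doublings_left_le _ Ml1; rewrite /cycle_length.
  by rewrite addr0; lra.
move=> [[mm Dx0 Dy /andP[LM LL] tauE] [At inv]]; right.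
have mu0 : 0 < mu by apply: lt_le_trans mm; rewrite divr_gt0.
have L0 : 0 < tr_L t by exact: lt_le_trans LM.
have A0 : 0 <= tr_A t by case: At => [->//|/AmaxD[/ltW]].
have tau0 : 0 < tr_tau t.
  by rewrite tauE ltr_pwDl// divr_ge0// mulr_ge0// ltW.
have I1 := iterations_left_ge1 _ At.
have D1 := doublings_left_ge1 (tr_L t); rewrite L0 LL in D1.
have {}D1 := D1 isT.
have C0 : 0 <= 3 * cycle_length * cycles_left mu.
  by apply: mulr_ge0; [rewrite mulr_ge0// cycle_length_ge0|exact: cycles_left_ge0].
have [Dyn res] := trial_residual t L0.
split.
  have [bt|bt] := pselect (tr_backtrack ip f h chi t).
    by eexists; eexists; apply: Step_backtrack.
  have [ck|ck] := pselect (tr_check ip f h chi x0 t).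
    have [ve|ve] := leP `|vnew t| eps.
      by eexists; eexists; apply: Step_output.
    by eexists; eexists; apply: Step_continue.
  by eexists; eexists; apply: Step_restart.
move=> q s' st; inversion st as [|l' mu' x0' t' bt|l' mu' x0' t' bt ck
  |l' mu' x0' t' bt ck ve|l' mu' x0' t' bt ck ve]; subst => /=.
- have LL2 := backtrack_bound t L0 bt; split.
    by split=> //; split=> //; rewrite LL2 (le_trans LM)//; lra.
  by have := doublings_left_double _ L0; lra.
- have mub : mubar < mu.
    rewrite ltNge; apply/negP => mum; apply: ck.
    apply: (accepted_check mu) => //; first by rewrite mum ltW.
    exact: inv.
  split; first by rewrite LM LL; split=> //; rewrite ler_pM2r ?invr_gt0// ltW.
  by rewrite -(cycles_left_half _ mu0) in C0 *; lra.
- have [a0 aE] := tr_a_quadratic t A0 tau0 L0.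
  have An0 : 0 < tr_Anew t by rewrite /tr_Anew ltr_wpDl.
  have AnM : tr_Anew t < Amax.
    apply: (continue_bound t x0) => //; last exact: ltW.
    by rewrite LM LL.
  have gr : (1 + rho) * tr_A t <= tr_Anew t.
    apply: (tr_A_growth t mu) => //; [exact: ltW|exact: ltW|].
    have : 4 * rho ^+ 2 * tr_L t <= 4 * rho ^+ 2 * Lmax.
      by rewrite ler_wpM2l// mulr_ge0 ?sqr_ge0.
    by have := rhoE; lra.
  have AnL : Lmax^-1 <= tr_Anew t.
    case: At => [A00|/andP[AL _]].
      rewrite tr_a_first ?lef_pV2 ?posrE//.
      by rewrite tauE A00 !mul0r addr0.
    by apply: (le_trans AL); rewrite /tr_Anew lerDl ltW.
  have AnI : Lmax^-1 <= tr_Anew t < Amax by rewrite AnL AnM.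
  split.
    split; first by split; rewrite ?LM ?LL//; exact: tr_taunewE.
    split; first by right.
    move=> mub x Dx; have mub' : 0 <= mu <= mubar by rewrite mub ltW.
    have := estimate_sequence_step mu t x mub' A0 tau0 L0 Dy Dx bt.
    have := inv mub x Dx.
    have : 0 <= chi * tr_Anew t * tr_L t / 2 * `|ynew t - tr_xt t| ^+ 2.
      rewrite mulr_ge0 ?sqr_ge0// divr_ge0// !mulr_ge0 ?(ltW An0) ?(ltW L0)//.
      by apply: ltW; case/andP: chi01.
    lra.
  by have := iterations_left_next _ _ At AnI gr; lra.
- by split=> //; lra.
Qed.

End RFistaComplexity.

(** * Linear maps on a Euclidean space *)
Section LinearMapBounds.
Context {R : realType} {E : normedModType R} {m : nat}.
Variable ip : {dot E for idfun}.
Hypothesis hE : is_euclidean ip.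
Variable A : {linear E -> 'cV[R]_m}.

Lemma adjointP q z : edot (A z) q = ip z (adjoint ip A q).
Proof.
rewrite /adjoint; set P := [set u | _].
have [g gP] : exists g, forall v, edot (A v) q = ip g v.
  by apply: (Riesz ip hE) => *; rewrite ?linearD ?linearZ ?edotDl// edotZl.
have : P (xget 0 P) by apply: xgetPex; exists g => v; rewrite gP (ipC ip).
exact.
Qed.

Lemma adjointB p q : adjoint ip A (p - q) = adjoint ip A p - adjoint ip A q.
Proof.
apply: (ip_inj ip hE) => w; rewrite (ipC ip) -adjointP.
by rewrite !(edot_lin) (ipDl ip) (ipNl ip) !(ipC ip _ w) -!adjointP.
Qed.

Lemma linear_enorm_bounded :
  exists2 k, 0 < k & forall z, enorm (A z) <= k * `|z|.
Proof.
pose a i := adjoint ip A (delta_mx i 0).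
have Aza z i : A z i 0 = ip z (a i).
  rewrite -adjointP /edot (bigD1 i)//= mxE !eqxx mulr1 big1 ?addr0// => j ji.
  by rewrite mxE (negbTE ji) mulr0.
have S0 : 0 <= \sum_i `|a i| ^+ 2 by apply: sumr_ge0 => i _; exact: sqr_ge0.
exists (1 + Num.sqrt (\sum_i `|a i| ^+ 2)).
  by rewrite ltr_pwDl// sqrtr_ge0.
move=> z; apply: (@le_trans _ _ (Num.sqrt (\sum_i `|a i| ^+ 2) * `|z|)).
  rewrite -[X in _ * X]ger0_norm// -sqrtr_sqr -sqrtrM//; apply: ler_wsqrtr.
  rewrite mulr_suml; apply: ler_sum => i _; rewrite -expr2 -(real_normK (num_real (A z i 0))) -exprMn.
  rewrite ler_pXn2r ?nnegrE ?mulr_ge0// Aza ler_norml lerNl -(ipNl ip).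
  rewrite mulrC (le_trans (ip_le ip hE _ _))/=; first exact: ip_le.
  by rewrite normrN.
by rewrite ler_wpM2r// lerDr.
Qed.

Lemma adjoint_bounded k : 0 <= k -> (forall z, enorm (A z) <= k * `|z|) ->
  forall q, `|adjoint ip A q| <= k * enorm q.
Proof.
move=> k0 hk q; have [->|n0] := eqVneq (adjoint ip A q) 0.
  by rewrite normr0 mulr_ge0// enorm_ge0.
rewrite -(ler_pM2l (_ : 0 < `|adjoint ip A q|)) ?normr_gt0//.
rewrite -expr2 (norm_sqE ip) // -adjointP mulrA (mulrC _ k).
by apply: (le_trans (edot_le _ _)); rewrite ler_wpM2r ?enorm_ge0.
Qed.

(** In coordinates with respect to a spanning family, a generalized inverse of
    the matrix of [A] is a linear, hence bounded, right inverse of [A] on its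
    range. Its bound plays the part of the inverse of the smallest positive
    singular value. *)
Lemma bounded_preimage : exists2 k, 0 < k &
  forall u, exists2 w, A w = A u & `|w| <= k * enorm (A u).
Proof.
have [n [e spane]] := hE.2.
pose M : 'M[R]_(n, m) := \matrix_(i, j) A (e i) j 0.
have Asum (c : 'rV[R]_n) : A (\sum_i c 0 i *: e i) = (c *m M)^T.
  rewrite linear_sum; apply/matrixP => i j; rewrite ord1 summxE !mxE.
  by apply: eq_bigr => l _; rewrite linearZ !mxE.
pose P := pinvmx M.
pose k i := (\sum_j `|P j i|) * `|e i|.
have k0 i : 0 <= k i by rewrite mulr_ge0// sumr_ge0.
exists (1 + \sum_i k i); first by rewrite ltr_pwDl// sumr_ge0.
move=> u; have [c uc] := spane u.
have AuM : ((A u)^T <= M)%MS.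
  apply/submxP; exists (\row_i c i); rewrite -[RHS]trmxK -Asum; congr (_ ^T).
  by rewrite {1}uc; congr (A _); apply: eq_bigr => i _; rewrite mxE.
pose d := (A u)^T *m P.
exists (\sum_i d 0 i *: e i); first by rewrite Asum /d mulmxKpV// trmxK.
rewrite mulrDl mul1r ler_wpDl ?enorm_ge0//.
apply: (le_trans (ler_norm_sum _ _ _)); rewrite mulr_suml; apply: ler_sum => i _.
rewrite normrZ /k mulrAC ler_wpM2r// /d mxE.
apply: (le_trans (ler_norm_sum _ _ _)); rewrite mulr_suml; apply: ler_sum => j _.
by rewrite normrM mxE mulrC ler_wpM2l// coord_le_enorm.
Qed.

End LinearMapBounds.

(** * The augmented Lagrangian *)
Section AugmentedLagrangian.
Context {R : realType} {E : normedModType R} {m : nat}.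
Variable ip : {dot E for idfun}.
Hypothesis hE : is_euclidean ip.
Variables (A : {linear E -> 'cV[R]_m}) (b : 'cV[R]_m) (kA : R).
Hypotheses (kA_ge0 : 0 <= kA) (A_le : forall z, enorm (A z) <= kA * `|z|).
Variables (psi_s : E -> R) (Lbar : R).
Hypothesis hs_convex : convex_fun (fun z => (psi_s z)%:E).
Hypothesis hs_diff : forall z, differentiable (psi_s : E -> R^o) z.
Hypothesis hs_lip : Lbar.-lipschitz (grad ip psi_s).

Lemma grad_lipschitz x v :
  `|grad ip psi_s x - grad ip psi_s v| <= Lbar * `|x - v|.
Proof. exact: (hs_lip (x, v)). Qed.

(** Convexity at [v] and the Lipschitz gradient replace integration along the
    segment, at the price of the constant [Lbar] instead of [Lbar / 2]. *)
Lemma smooth_convex_upper x v :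
  psi_s v <= psi_s x + ip (grad ip psi_s x) (v - x) + Lbar * `|v - x| ^+ 2.
Proof.
have := convex_ge_linearization ip hE _ v x hs_convex (hs_diff v).
rewrite -opprB (ipNr ip) => lo.
have : ip (grad ip psi_s v - grad ip psi_s x) (v - x) <= Lbar * `|v - x| ^+ 2.
  apply: (le_trans (ip_le ip hE _ _)).
  by rewrite expr2 mulrA ler_wpM2r// grad_lipschitz.
rewrite (ipDl ip) (ipNl ip); lra.
Qed.

Lemma aug_lagr_expand c p x v :
  aug_lagr A b psi_s c p v = aug_lagr A b psi_s c p x + (psi_s v - psi_s x)
  + ip (adjoint ip A (apf_mult A b p c x)) (v - x)
  + c / 2 * enorm (A (v - x)) ^+ 2.
Proof.
rewrite /aug_lagr (ipC ip) -(adjointP ip hE) /apf_mult.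
have -> : A v - b = (A x - b) + A (v - x) by rewrite linearB [RHS]addrC subrKA.
move: (A x - b) (A (v - x)) => X V.
by rewrite !enorm_sq !edot_lin (edotC V X) (edotC V p); field.
Qed.

Definition aug_lipschitz c := Lbar + c * kA ^+ 2.

Let quad_bounds c x v : 0 <= c ->
  0 <= c / 2 * enorm (A (v - x)) ^+ 2 <= c * kA ^+ 2 * `|v - x| ^+ 2.
Proof.
move=> c0; rewrite mulr_ge0 ?sqr_ge0 ?divr_ge0//=.
have h : enorm (A (v - x)) ^+ 2 <= kA ^+ 2 * `|v - x| ^+ 2.
  by rewrite -exprMn ler_pXn2r ?nnegrE ?enorm_ge0 ?mulr_ge0.
rewrite -(mulrA c (kA ^+ 2)); apply: ler_pM; rewrite ?sqr_ge0 ?divr_ge0//; lra.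
Qed.

Lemma grad_aug_lagr c p x : 0 <= c ->
  grad ip (aug_lagr A b psi_s c p) x =
  grad ip psi_s x + adjoint ip A (apf_mult A b p c x).
Proof.
move=> c0; apply: (grad_of_quadratic_remainder ip hE _ _ _ (aug_lipschitz c)).
move=> v; rewrite (aug_lagr_expand c p x (x + v)).
have := convex_ge_linearization ip hE _ x (x + v) hs_convex (hs_diff x).
have := smooth_convex_upper x (x + v); have := quad_bounds c x (x + v) c0.
rewrite (addrC x v) addrK (addrC v x) (ipDl ip) /aug_lipschitz mulrDl.
move=> /andP[q0 q1] up lo; rewrite ger0_norm; lra.
Qed.

Lemma aug_lagr_lower c p x v : 0 <= c ->
  aug_lagr A b psi_s c p x + ip (grad ip (aug_lagr A b psi_s c p) x) (v - x)
  <= aug_lagr A b psi_s c p v.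
Proof.
move=> c0; rewrite grad_aug_lagr// (aug_lagr_expand c p x v) (ipDl ip).
have := convex_ge_linearization ip hE _ x v hs_convex (hs_diff x).
have /andP[] := quad_bounds c x v c0; lra.
Qed.

Lemma aug_lagr_upper c p x v : 0 <= c ->
  aug_lagr A b psi_s c p v <=
  aug_lagr A b psi_s c p x + ip (grad ip (aug_lagr A b psi_s c p) x) (v - x)
  + aug_lipschitz c * `|v - x| ^+ 2.
Proof.
move=> c0; rewrite grad_aug_lagr// (aug_lagr_expand c p x v) (ipDl ip).
have := smooth_convex_upper x v.
have /andP[] := quad_bounds c x v c0; rewrite /aug_lipschitz mulrDl; lra.
Qed.

Lemma grad_aug_lagr_lipschitz c p x v : 0 <= c ->
  `|grad ip (aug_lagr A b psi_s c p) x - grad ip (aug_lagr A b psi_s c p) v|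
  <= aug_lipschitz c * `|x - v|.
Proof.
move=> c0; rewrite !grad_aug_lagr// opprD addrACA -(adjointB ip hE).
have -> : apf_mult A b p c x - apf_mult A b p c v = c *: A (x - v).
  rewrite /apf_mult opprD addrACA subrr add0r -scalerBr; congr (_ *: _).
  by rewrite opprB addrA subrK linearB.
apply: (le_trans (ler_normD _ _)); rewrite mulrDl lerD ?grad_lipschitz//.
apply: (le_trans (adjoint_bounded ip hE A kA kA_ge0 A_le _)).
rewrite enormZ ger0_norm// expr2 mulrCA -!mulrA ler_wpM2l// ler_wpM2l//.
Qed.

(** The penalty terms are convex, so the strong convexity of [psi_s + h] passes
    to the augmented Lagrangian plus [h]; the midpoint case is the one used by
    the lower models. *)
Lemma aug_lagr_midpoint c p (h : E -> \bar R) mubar x y : 0 <= c ->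
  proper_fun h -> convex_fun h ->
  strongly_convex_fun mubar (fun z => ((psi_s z)%:E + h z)%E) ->
  effdom h x -> effdom h y ->
  aug_lagr A b psi_s c p (2^-1 *: x + 2^-1 *: y)
    + fine (h (2^-1 *: x + 2^-1 *: y))
  <= (aug_lagr A b psi_s c p x + fine (h x)
      + (aug_lagr A b psi_s c p y + fine (h y))) / 2
     - mubar / 8 * `|x - y| ^+ 2.
Proof.
move=> c0 hp hc sc Dx Dy; have half : 0 < (2^-1 : R) < 1 by lra.
have halfB : 1 - 2^-1 = 2^-1 :> R by field.
have [Dw _] := effdom_convex h hp hc x y _ Dx Dy half.
have : psi_s (2^-1 *: x + 2^-1 *: y) + fine (h (2^-1 *: x + 2^-1 *: y))
    + mubar / 2 * 2^-1 * 2^-1 * `|x - y| ^+ 2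
    <= 2^-1 * (psi_s x + fine (h x)) + 2^-1 * (psi_s y + fine (h y)).
  have := sc x y _ half; rewrite halfB in Dw *.
  rewrite {1}(effdom_fineK _ hp _ Dx) {1}(effdom_fineK _ hp _ Dy).
  by rewrite {1}(effdom_fineK _ hp _ Dw).
set w := 2^-1 *: x + _.
have Aw : A w - b = 2^-1 *: (A x - b) + 2^-1 *: (A y - b).
  rewrite /w linearD !linearZ !scalerBr addrACA; congr (_ + _).
  by rewrite -opprD -scalerDl (_ : 2^-1 + 2^-1 = 1 :> R) ?scale1r//; field.
rewrite /aug_lagr Aw !enorm_sq.
have := edot_ge0 (A x - b - (A y - b)).
move: (A x - b) (A y - b) => X Y; rewrite !edot_lin (edotC Y X) => XY.
have := ler_wpM2l c0 XY; rewrite mulr0. lra.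
Qed.

End AugmentedLagrangian.

(** * Boundedness of the multipliers *)
Section Multipliers.
Context {R : realType} {E : normedModType R} {m : nat}.
Variable ip : {dot E for idfun}.
Hypothesis hE : is_euclidean ip.
Variables (A : {linear E -> 'cV[R]_m}) (b : 'cV[R]_m).
Variables (h : E -> \bar R) (Mn Dm kR del : R) (zbar : E).
Hypothesis h_proper : proper_fun h.
Hypothesis h_lip : Mn.-lipschitz_(effdom h) (fun z => fine (h z) : R^o).
Hypothesis D_bounded : forall x y, effdom h x -> effdom h y -> `|x - y| <= Dm.
Hypothesis kR_gt0 : 0 < kR.
Hypothesis preim :
  forall u, exists2 w, A w = A u & `|w| <= kR * enorm (A u).
Hypothesis del_gt0 : 0 < del.
Hypothesis slater : forall z, `|z - zbar| <= del -> effdom h z.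
Hypothesis Azbar : A zbar = b.

(** Test the subgradient [g] at the Slater point moved by a step of length at
    most [del] along which [A] decreases in the direction of
    [q = p' - p0], where [p'] is the new multiplier; [q] lies in the range of
    [A]. This step contributes about [del / kR * |q|] to the subgradient
    inequality. If [|p'| > B >= |p|], then
    [<p', A z - b> = <p', p' - p> / c] is nonnegative, and the remaining terms
    are bounded on the domain, which forces [|p'| <= B]. *)
Lemma multiplier_bounded (p0 p : 'cV[R]_m) (c : R) (z s g : E) (B gs : R) :
  0 < c -> effdom h z -> (exists u, p = p0 + A u) -> enorm p <= B ->
  subdiff ip h z g -> s + adjoint ip A (apf_mult A b p c z) = - g ->
  `|s| <= gs ->
  2 * enorm p0 + kR / del * ((`|Mn| + gs) * Dm) <= B ->
  (exists u, apf_mult A b p c z = p0 + A u) /\ enorm (apf_mult A b p c z) <= B.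
Proof.
move=> c0 Dz [u pu] pB gz sg sgs Bb.
set p' := apf_mult A b p c z in sg *.
have p'u : p' = p0 + A (u + c *: (z - zbar)).
  by rewrite linearD linearZ linearB Azbar addrA -pu.
split; first by eexists; exact: p'u.
rewrite leNgt; apply/negP => Bp'.
pose q := A (u + c *: (z - zbar)).
have p'q : p' = p0 + q by [].
have np' : enorm p' <= enorm p0 + enorm q by rewrite p'q enormD.
have Dm0 : 0 <= Dm by rewrite (le_trans _ (D_bounded _ _ Dz Dz)).
have gs0 : 0 <= gs by rewrite (le_trans _ sgs).
have K0 : 0 <= kR / del * ((`|Mn| + gs) * Dm).
  by rewrite mulr_ge0 ?divr_ge0 ?(ltW kR_gt0) ?(ltW del_gt0)// mulr_ge0// addr_ge0.
have q0 : 0 < enorm q by have := enorm_ge0 p0; lra.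
have [w Aw wle] := preim (u + c *: (z - zbar)).
pose t := del / (kR * enorm q).
have t0 : 0 < t by rewrite divr_gt0// mulr_gt0.
pose x := zbar - t *: w.
have Dx : effdom h x.
  apply: slater; rewrite /x addrAC subrr add0r normrN normrZ gtr0_norm//.
  rewrite /t mulrAC ler_pdivrMr ?mulr_gt0//.
  by apply: ler_wpM2l; [exact: ltW|exact: wle].
have sub := (subdiffP ip h h_proper _ g Dz).1 gz x Dx.
have gE : ip g (x - z) = - ip s (x - z) - edot (A (x - z)) p'.
  rewrite -[g]opprK -sg (ipNl ip) (ipDl ip) opprD; congr (_ - _).
  by rewrite (adjointP ip hE) (ipC ip).
have Ax : A (x - z) = - (A z - b) - t *: q.
  by rewrite /x !(linearB A) linearZ Aw Azbar -/q opprB addrAC.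
have lipx : fine (h x) - fine (h z) <= `|Mn| * Dm.
  apply: (le_trans (ler_norm _)).
  apply: (le_trans (fine_lipschitz _ _ h_lip _ _ Dx Dz)).
  apply: (le_trans (ler_wpM2r _ (ler_norm Mn))) => //.
  by rewrite ler_wpM2l// D_bounded.
have ips : ip s (x - z) <= gs * Dm.
  apply: (le_trans (ip_le ip hE _ _)).
  by rewrite ler_pM ?D_bounded.
have feas : 0 <= edot (A z - b) p'.
  rewrite -(pmulr_rge0 _ c0) -edotZl.
  have -> : c *: (A z - b) = p' - p by rewrite /p' /apf_mult addrAC subrr add0r.
  rewrite edotDl edotNl -enorm_sq subr_ge0; apply: (le_trans (edot_le _ _)).
  by rewrite expr2 ler_wpM2r ?enorm_ge0//; lra.
have qp : enorm q * (enorm q - enorm p0) <= edot q p'.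
  rewrite p'q edotDr -enorm_sq.
  have := edot_le q (- p0); rewrite edotNr enormN; lra.
have tqp : t * (enorm q * (enorm q - enorm p0)) <= t * edot q p'.
  by rewrite ler_wpM2l// ltW.
clearbody p' q; move: sub feas; rewrite gE Ax !edot_lin => sub feas.
have main : t * (enorm q * (enorm q - enorm p0)) <= (`|Mn| + gs) * Dm by lra.
have tq : t * (enorm q * (enorm q - enorm p0)) =
    del / kR * (enorm q - enorm p0).
  by rewrite /t; field; rewrite !gt_eqF.
move: main; rewrite tq mulrAC ler_pdivrMr// => main.
have : enorm q - enorm p0 <= kR / del * ((`|Mn| + gs) * Dm).
  by rewrite mulrAC ler_pdivlMr// mulrC [leRHS]mulrC.
lra.
Qed.

End Multipliers.

(** * The outer loop *)
Section OuterLoop.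
Context {R : realType} {E : normedModType R} {m : nat}.
Variable ip : {dot E for idfun}.
Hypothesis hE : is_euclidean ip.
Variables (A : {linear E -> 'cV[R]_m}) (b : 'cV[R]_m).
Variables (psi_s : E -> R) (Lbar : R).
Hypothesis Lbar_gt0 : 0 < Lbar.
Hypothesis hs_convex : convex_fun (fun z => (psi_s z)%:E).
Hypothesis hs_diff : forall z, differentiable (psi_s : E -> R^o) z.
Hypothesis hs_lip : Lbar.-lipschitz (grad ip psi_s).
Variables (psi_n : E -> \bar R) (Mn mubar : R).
Hypotheses (hn_proper : proper_fun psi_n) (hn_convex : convex_fun psi_n).
Hypothesis hn_dom : compact (effdom psi_n).
Hypothesis mubar_gt0 : 0 < mubar.
Hypothesis hpsi :
  strongly_convex_fun mubar (fun z => ((psi_s z)%:E + psi_n z)%E).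
Hypothesis hn_lip :
  Mn.-lipschitz_(effdom psi_n) (fun z => fine (psi_n z) : R^o).
Variables (zbar z0 : E) (p0 : 'cV[R]_m).
Variables (c1 alpha omega et1 chi mu0 M0 ehat rhat : R).
Hypotheses (Azbar : A zbar = b) (hz0 : effdom psi_n z0).
Hypotheses (c1_gt0 : 0 < c1) (alpha_gt1 : 1 < alpha) (omega_gt1 : 1 < omega).
Hypotheses (chi01 : 0 < chi < 1) (mubar_le_mu0 : mubar <= mu0).
Hypotheses (M0_gt0 : 0 < M0) (ehat_gt0 : 0 < ehat) (rhat_gt0 : 0 < rhat).
Hypothesis rhat_le_et1 : rhat <= et1.
(** [cstar] is the penalty from which on the constraint is met up to
    [ehat], [Q * c]
    dominates the curvature estimates of a call with penalty [c], and
    [K * Num.sqrt c] dominates its cost. *)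
Variables (kA kR del Dm gs B Q cstar Amax K : R).
Hypotheses (kA_ge0 : 0 <= kA) (A_le : forall z, enorm (A z) <= kA * `|z|).
Hypothesis D_bounded : forall x y, effdom psi_n x -> effdom psi_n y ->
  `|x - y| <= Dm.
Hypothesis kR_gt0 : 0 < kR.
Hypothesis preim :
  forall u, exists2 w, A w = A u & `|w| <= kR * enorm (A u).
Hypothesis del_gt0 : 0 < del.
Hypothesis slater : forall z, `|z - zbar| <= del -> effdom psi_n z.
Hypothesis grad_le : forall z, effdom psi_n z -> `|grad ip psi_s z| <= gs.
Hypothesis B_ge :
  2 * enorm p0 + kR / del * ((`|Mn| + (et1 + gs)) * Dm) <= B.
Hypothesis p0_le_B : enorm p0 <= B.
Hypotheses (cstarE : 2 * B <= ehat * cstar) (c1_le_cstar : c1 <= cstar).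
Hypothesis Q_ge : forall c, c1 <= c ->
  M0 + 8 * (Lbar + c * kA ^+ 2) / (1 - chi) <= Q * c.
Hypothesis Amax_ge : forall c, c1 <= c <= alpha ^+ 2 * cstar ->
  4 * (Q * c) ^+ 2 * Dm ^+ 2 <= Amax * (chi * M0 * rhat ^+ 2).
Hypothesis Amax_ge1 : 1 <= Amax * M0.

Definition growth_rate (c : R) : R := Num.sqrt (mubar / (4 * (Q * c))).

Local Notation inner_potential c :=
  (rfista_potential (E := E) M0 mubar (Q * c) Amax (growth_rate c)).
Local Notation inner_inv c p eps :=
  (rfista_inv ip (aug_lagr A b psi_s c p) psi_n M0 eps mubar (Q * c) Amax).

Hypothesis K_ge0 : 0 <= K.
Hypothesis K_ge : forall c, c1 <= c <= alpha ^+ 2 * cstar ->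
  inner_potential c (NewCycle 1 M0 mu0) + 2 <= K * Num.sqrt c.

(** Once [c >= cstar] the iterate produced is nearly feasible, so the next call
    runs with tolerance [rhat] and is the last one. This is the second
    alternative for [c], and it keeps all penalties below
    [alpha ^+ 2 * cstar]. *)
Definition apf_inv (s : apf_state (R := R) (E := E) (m := m)) : Prop :=
  match s with
  | ApfStart => True
  | ApfSolve z p c et eps st =>
    [/\ c1 <= c, rhat <= eps <= et1, 0 <= et <= et1 & effdom psi_n z] /\
    [/\ exists u, p = p0 + A u, enorm p <= B,
        c <= alpha * cstar \/
          [/\ cstar <= c, c <= alpha ^+ 2 * cstar & eps = rhat]
      & inner_inv c p eps st]
  | ApfOutput z p r => approx_solution ip A b psi_s psi_n ehat rhat z p r
  end.

(** The sum of the geometric progression [K sqrt (alpha^i c)], [i >= 1], up to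
    the penalty [d] is at most [outer_rate * (sqrt d - sqrt c)]. *)
Definition outer_rate : R := K * Num.sqrt alpha / (Num.sqrt alpha - 1).

Definition apf_potential (s : apf_state (R := R) (E := E) (m := m)) : R :=
  match s with
  | ApfStart =>
    4 + K * Num.sqrt c1 + outer_rate * Num.sqrt (alpha ^+ 2 * cstar)
  | ApfSolve z p c et eps st =>
    inner_potential c st + 1
    + outer_rate * (Num.sqrt (alpha ^+ 2 * cstar) - Num.sqrt c)
  | ApfOutput z p r => 0
  end.

Let cstar_gt0 : 0 < cstar. Proof. exact: lt_le_trans c1_le_cstar. Qed.

Let alpha_gt0 : 0 < alpha. Proof. exact: lt_trans alpha_gt1. Qed.

Let sqrt_alpha_gt1 : 0 < Num.sqrt alpha - 1.
Proof. by rewrite subr_gt0 -[ltLHS]sqrtr1 ltr_sqrt. Qed.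

Let alphaD : alpha * cstar <= alpha ^+ 2 * cstar.
Proof. by rewrite ler_pM2r// expr2 ler_peMl// ltW. Qed.

Let penalty_le c (P : Prop) :
  c <= alpha * cstar \/ [/\ cstar <= c, c <= alpha ^+ 2 * cstar & P] ->
  c <= alpha ^+ 2 * cstar.
Proof. by case=> [/le_trans|[]//]; apply. Qed.

Let Q_gt0 : 0 < Q.
Proof.
have := Q_ge _ (lexx c1) => h.
have : 0 < Q * c1.
  apply: lt_le_trans h; rewrite ltr_pwDl// divr_ge0//.
    by rewrite mulr_ge0// addr_ge0 ?mulr_ge0 ?sqr_ge0 ?(ltW Lbar_gt0) ?(ltW c1_gt0).
  by rewrite subr_ge0 ltW//; case/andP: chi01.
by rewrite pmulr_lgt0.
Qed.

(** The augmented Lagrangian of each call fits the setting of R-FISTA with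
    [Lmax = Q * c]. *)
Lemma inner_progress z p c eps st :
  c1 <= c <= alpha ^+ 2 * cstar -> rhat <= eps -> effdom psi_n z ->
  inner_inv c p eps st ->
  (exists y v, st = Output y v) \/
  ((exists q s',
      rfista_step ip (aug_lagr A b psi_s c p) psi_n chi M0 eps z st q s') /\
   forall q s',
     rfista_step ip (aug_lagr A b psi_s c p) psi_n chi M0 eps z st q s' ->
     inner_inv c p eps s' /\
     inner_potential c s' + q%:R + 1 <= inner_potential c st).
Proof.
move=> cc /[dup] re /(lt_le_trans rhat_gt0) eps0 Dz; have /andP[cl _] := cc.
have c0 : 0 < c by exact: lt_le_trans cl.
have Qc : 0 < 4 * (Q * c) by rewrite !mulr_gt0.
have cge0 := ltW c0; have Lge0 := ltW Lbar_gt0.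
apply: (rfista_progress ip hE _ _ _ _ _ _ (aug_lipschitz kA Lbar c) Mn _ Dm) => //.
- by rewrite addr_ge0 ?mulr_ge0 ?sqr_ge0.
- by rewrite sqrtr_gt0 divr_gt0.
- by move=> x v; apply: (aug_lagr_lower ip hE A b kA _ _ psi_s Lbar).
- by move=> x v; apply: (aug_lagr_upper ip hE A b kA _ _ psi_s Lbar).
- by move=> x v; apply: (grad_aug_lagr_lipschitz ip hE A b kA _ _ psi_s Lbar).
- by move=> x y Dx Dy; exact: aug_lagr_midpoint.
- exact: Q_ge.
- apply: (le_trans (Amax_ge _ cc)); rewrite ler_wpM2l//.
    have := lt_le_trans ltr01 Amax_ge1; rewrite pmulr_lgt0//; exact: ltW.
  rewrite ler_wpM2l ?ler_pXn2r ?nnegrE ?(ltW eps0) ?(ltW rhat_gt0)//.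
  by rewrite mulr_ge0 ?(ltW M0_gt0)// ltW//; case/andP: chi01.
- rewrite /growth_rate sqr_sqrtr ?divr_ge0 ?(ltW Qc) ?(ltW mubar_gt0)//.
  have -> : 4 * (mubar / (4 * (Q * c))) * (Q * c) = mubar.
    by field; rewrite !gt_eqF.
  exact: lexx.
Qed.

Let outer_rate_ge0 : 0 <= outer_rate.
Proof. by rewrite divr_ge0 ?mulr_ge0 ?sqrtr_ge0 ?(ltW sqrt_alpha_gt1). Qed.

Lemma call_inv z p c et :
  c1 <= c -> 0 <= et <= et1 -> effdom psi_n z ->
  (exists u, p = p0 + A u) -> enorm p <= B ->
  c <= alpha * cstar \/
    [/\ cstar <= c, c <= alpha ^+ 2 * cstar & enorm (A z - b) <= ehat] ->
  apf_inv (apf_call A b mu0 M0 ehat rhat z p c et).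
Proof.
move=> cc /andP[et0 et1'] Dz pu pB cs; rewrite /apf_call /=.
have M0Q : M0 <= Q * c.
  apply: le_trans (Q_ge _ cc); rewrite lerDl divr_ge0//.
    rewrite mulr_ge0// addr_ge0 ?mulr_ge0 ?sqr_ge0 ?(ltW Lbar_gt0)//.
    exact: le_trans (ltW c1_gt0) cc.
  by rewrite subr_ge0 ltW//; case/andP: chi01.
split; split=> //.
- rewrite /apf_tol; case: ifP => _; last by rewrite lexx.
  by rewrite le_max lexx orbT ge_max et1' rhat_le_et1.
- by rewrite et0.
- case: cs => [?|[? ? fe]]; [by left|right; split=> //].
  by rewrite /apf_tol ltNge fe.
- rewrite lexx M0Q; split=> //; apply: le_trans mubar_le_mu0.
  by have := mubar_gt0; lra.
Qed.

Lemma outer_rate_pays c :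
  K * Num.sqrt (alpha * c) + outer_rate * Num.sqrt c
  = outer_rate * Num.sqrt (alpha * c).
Proof.
rewrite sqrtrM ?(ltW alpha_gt0)// /outer_rate.
by field; rewrite lt0r_neq0.
Qed.

(** A transition inside a call is paid by the potential of R-FISTA. The output
    of a call keeps the multiplier bounded, and the next call is paid by the
    growth of [sqrt c]. *)
Lemma apf_progress s : apf_inv s ->
  apf_success ip A b psi_s psi_n ehat rhat s \/
  ((exists q s', apf_step ip A b psi_s psi_n chi mu0 M0 alpha omega
      z0 p0 c1 et1 ehat rhat s q s') /\
   forall q s', apf_step ip A b psi_s psi_n chi mu0 M0 alpha omega
      z0 p0 c1 et1 ehat rhat s q s' ->
     apf_inv s' /\ apf_potential s' + q%:R + 1 <= apf_potential s).
Proof.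
case: s => [_|z p c et eps st|z p r] /=; last by left.
  right; split; first by eexists; eexists; exact: Apf_start.
  move=> q s' st; inversion st; subst; split.
    apply: call_inv => //.
    - by rewrite lexx andbT (le_trans (ltW rhat_gt0)).
    - by exists 0; rewrite linear0 addr0.
    - by left; rewrite (le_trans c1_le_cstar)// ler_peMl ?ltW.
  have c1c : c1 <= c1 <= alpha ^+ 2 * cstar.
    rewrite lexx (le_trans c1_le_cstar)// ler_peMl ?(ltW cstar_gt0)//.
    by rewrite exprn_ege1// ltW.
  have := K_ge _ c1c; rewrite /=.
  have : 0 <= outer_rate * Num.sqrt c1 by rewrite mulr_ge0 ?sqrtr_ge0.
  lra.
move=> [[cl /andP[re ee] /andP[et0 et1'] Dz] [pu pB cs inv]]; right.
have cu := penalty_le _ _ cs.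
have cc : c1 <= c <= alpha ^+ 2 * cstar by rewrite cl.
have c0 : 0 < c by exact: lt_le_trans cl.
have [[y [v stE]]|[[q0 [s0 st0]] all]] := inner_progress z p c eps st cc re Dz inv;
  last first.
  split; first by eexists; eexists; apply: Apf_inner; exact: st0.
  move=> q s' ss; inversion ss as [|z' p' c' et' eps' t' q' s'' sin| |]; subst.
  - have [inv' V'] := all _ _ sin; split; first by split=> //; rewrite ?re ?et0.
    by rewrite /=; lra.
  - by inversion st0.
  - by inversion st0.
subst st; case: inv => Dy [g sg vE] ve.
have gradE : v = grad ip psi_s y + adjoint ip A (apf_mult A b p c y) + g.
  by rewrite vE (grad_aug_lagr ip hE A b kA kA_ge0 A_le psi_s Lbar)// ltW.
have sgE : (grad ip psi_s y - v) + adjoint ip A (apf_mult A b p c y) = - g.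
  by rewrite gradE !opprD !addrA subrr add0r addrAC addNr add0r.
have sle : `|grad ip psi_s y - v| <= et1 + gs.
  apply: (le_trans (ler_normB _ _)); rewrite addrC lerD ?grad_le//.
  exact: le_trans ve ee.
have [p'u p'B] := multiplier_bounded ip hE A b psi_n Mn Dm kR del zbar hn_proper
  hn_lip D_bounded kR_gt0 preim del_gt0 slater Azbar p0 p c y _ g B (et1 + gs)
  c0 Dy pu pB sg sgE sle B_ge.
(* c (A y - b) is the difference of two multipliers of norm at most B *)
have feas : cstar <= c -> enorm (A y - b) <= ehat.
  move=> csc; rewrite -(ler_pM2l c0) -[X in X * enorm _]gtr0_norm// -enormZ.
  have -> : c *: (A y - b) = apf_mult A b p c y - p.
    by rewrite /apf_mult addrAC subrr add0r.
  apply: (le_trans (enormD _ _)); rewrite enormN.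
  have : ehat * cstar <= c * ehat by rewrite mulrC ler_pM2r.
  have := cstarE; lra.
split.
  have [stp|stp] := pselect (apf_stop A b ehat rhat y v).
    by eexists; eexists; exact: Apf_stop.
  by eexists; eexists; exact: Apf_next.
have rest0 : 0 <= outer_rate * (Num.sqrt (alpha ^+ 2 * cstar) - Num.sqrt c).
  by rewrite mulr_ge0// subr_ge0 ler_wsqrtr.
move=> q s' ss; inversion ss as [|z' p' c' et' eps' t' q' s'' sin
  |z' p' c' et' eps' y' v' stp|z' p' c' et' eps' y' v' nst]; subst.
- by inversion sin.
- case: stp => fe rv; split; last by rewrite /=; lra.
  by split=> //; exists g => //; rewrite gradE addrAC.
- have ac : c1 <= alpha * c by rewrite (le_trans cl)// ler_peMl ?ltW.
  have csa : c <= alpha * cstar.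
    case: cs => [//|[cs1 _ er]]; case: nst; split; first exact: feas.
    by rewrite -er.
  have acu : alpha * c <= alpha ^+ 2 * cstar.
    by rewrite expr2 -mulrA ler_pM2l.
  split.
    apply: call_inv => //.
    - rewrite divr_ge0 ?(le_trans _ (ltW omega_gt1))//=.
      apply: le_trans et1'; rewrite ler_pdivrMr ?(lt_trans _ omega_gt1)//.
      by rewrite ler_peMr ?(ltW omega_gt1).
    - have [lt|ge] := ltP c cstar.
        by left; rewrite ler_pM2l// ltW.
      right; split=> //; last exact: feas.
      by rewrite (le_trans ge)// ler_peMl ?ltW.
  have := K_ge (alpha * c); rewrite ac acu => /(_ isT).
  have := outer_rate_pays c; rewrite /=; lra.
Qed.

Lemma apf_complexity_bound : exists2 N,
  apf_solves_within ip A b psi_s psi_n chi mu0 M0 alpha omega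
    z0 p0 c1 et1 ehat rhat N &
  N%:R <= 4 + K * Num.sqrt c1 + outer_rate * Num.sqrt (alpha ^+ 2 * cstar).
Proof.
apply: (all_runs_reach_potential _ _ _ _ apf_inv apf_potential _ apf_progress
  (@ApfStart _ _ _)) => // s; case: s => [_|z p c et eps st|z p r] //=.
  by rewrite !addr_ge0 ?(mulr_ge0 K_ge0) ?(mulr_ge0 outer_rate_ge0) ?sqrtr_ge0.
move=> [[cl _ _ _] [_ _ cs inv]]; have cu := penalty_le _ _ cs.
have c0 : 0 < c by exact: lt_le_trans cl.
rewrite !addr_ge0//; last by rewrite mulr_ge0// subr_ge0 ler_wsqrtr.
have Lge0 := ltW Lbar_gt0.
have chi1 : 0 <= 1 - chi by rewrite subr_ge0 ltW//; case/andP: chi01.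
apply: (rfista_potential_ge0 ip _ _ chi _ _ (aug_lipschitz kA Lbar c)) inv => //.
- by rewrite addr_ge0// mulr_ge0 ?sqr_ge0 ?(ltW c0).
- by rewrite sqrtr_gt0 divr_gt0// !mulr_gt0.
- exact: Q_ge.
Qed.

End OuterLoop.

(** * Dependence on the tolerances *)
Section Asymptotics.
Context {R : realType}.

Lemma inv_ln1p_le (rho : R) : 0 < rho -> (ln (1 + rho))^-1 <= 1 + rho^-1.
Proof.
move=> r0; have r1 : 0 < 1 + rho by rewrite ltr_wpDl.
have h : ln (1 + rho)^-1 <= - (rho / (1 + rho)).
  rewrite [in ln _](_ : (1 + rho)^-1 = 1 + - (rho / (1 + rho))); last first.
    by field; rewrite gt_eqF.
  by apply: le_ln1Dx; rewrite ltrN2 ltr_pdivrMr// mul1r ltrDr.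
move: h; rewrite lnV ?posrE// lerN2 => h.
have -> : 1 + rho^-1 = (rho / (1 + rho))^-1.
  by field; rewrite !gt_eqF.
by rewrite lef_pV2 ?posrE ?divr_gt0// ?ln_gt0 ?ltrDl.
Qed.

Definition log_factor (e r : R) : R := 1 + ln (e * r)^-1.

Lemma inv_mul_ge1 (e r : R) : 0 < e <= 1 -> 0 < r <= 1 -> 1 <= (e * r)^-1.
Proof.
move=> /andP[e0 e1] /andP[r0 r1]; rewrite invf_ge1 ?mulr_gt0//.
by rewrite mulr_ile1 ?(ltW e0) ?(ltW r0).
Qed.

Lemma ln_inv_mul_ge0 (e r : R) : 0 < e <= 1 -> 0 < r <= 1 -> 0 <= ln (e * r)^-1.
Proof. by move=> he hr; rewrite ln_ge0// inv_mul_ge1. Qed.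

Lemma log_factor_ge1 (e r : R) : 0 < e <= 1 -> 0 < r <= 1 -> 1 <= log_factor e r.
Proof. by move=> he hr; rewrite /log_factor lerDl ln_inv_mul_ge0. Qed.

(** The arguments of the logarithms that occur are bounded by powers of the
    inverse tolerances, so all these logarithms are of the same order. *)
Lemma ln_le_log_factor (t x e r : R) (n : nat) :
  0 < e <= 1 -> 0 < r <= 1 -> 0 < x -> 0 < t ->
  x <= t * (e * r)^-1 ^+ n ->
  ln x <= (`|ln t| + n%:R) * log_factor e r.
Proof.
move=> he hr x0 t0 le; have l0 := ln_inv_mul_ge0 _ _ he hr.
have y0 : 0 < (e * r)^-1 by apply: lt_le_trans ltr01 (inv_mul_ge1 _ _ he hr).
apply: (@le_trans _ _ (ln t + ln (e * r)^-1 * n%:R)).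
  rewrite mulr_natr -lnXn// -lnM ?posrE ?exprn_gt0//.
  by rewrite ler_ln ?posrE ?mulr_gt0 ?exprn_gt0.
rewrite /log_factor mulrDl lerD//.
  by rewrite (le_trans (ler_norm _))// ler_peMr// lerDl.
by rewrite mulrC ler_wpM2l// lerDr.
Qed.

End Asymptotics.

(** With [Lmax = Q * c], the inverse growth rate is of order [sqrt c]. The
    constant parts of the cost are absorbed by means of
    [1 <= sqrt c / sqrt c1]. *)
Lemma inner_cost_bound (R : realType) (E : normedModType R)
    (M0 mubar mu0 Q Th k0 c1 : R) :
  0 < M0 -> 0 < mubar -> mubar <= mu0 -> 0 < Q -> 0 < Th -> 0 < k0 ->
  0 < c1 ->
  exists2 k, 0 <= k & forall e r c, 0 < e <= 1 -> 0 < r <= 1 ->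
    c1 <= c <= k0 / e ->
    rfista_potential (E := E) M0 mubar (Q * c) (Th / (e * r) ^+ 2)
      (growth_rate mubar Q c) (NewCycle 1 M0 mu0) + 2
    <= k * log_factor e r * Num.sqrt c.
Proof.
move=> M00 mubar0 mub Q0 Th0 k00 c10.
have cyc : 0 <= cycles_left mubar mu0.
  rewrite divr_ge0 ?ln_ge0 ?ler1n// ler_pdivlMr// mul1r.
  have := le_trans (ltW mubar0) mub; lra.
have ln2 : 0 < ln 2 :> R by rewrite ln_gt0// ltr1n.
(* exponents: Amax * Lmax <= Th * Q * k0 / (e * r)^3, Lmax <= Q * k0 / (e * r) *)
pose a1 := `|ln (Th * Q * k0)| + 3%:R.
pose a2 := `|ln (Q * k0 / M0)| + 1%:R.
pose q1 := (Num.sqrt c1)^-1 + Num.sqrt (4 * Q / mubar).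
pose a3 := (4 + a2 / ln 2) / Num.sqrt c1 + a1 * q1.
have sc1 : 0 < Num.sqrt c1 by rewrite sqrtr_gt0.
have a10 : 0 <= a1 by rewrite addr_ge0.
have a20 : 0 <= a2 by rewrite addr_ge0.
have q10 : 0 <= q1 by rewrite addr_ge0 ?sqrtr_ge0 ?invr_ge0.
have a30 : 0 <= a3.
  rewrite addr_ge0 ?(mulr_ge0 a10)// divr_ge0 ?(ltW sc1)//.
  by rewrite addr_ge0// divr_ge0// ltW.
exists (3 * a3 * (1 + cycles_left mubar mu0) + 2 / Num.sqrt c1).
  rewrite addr_ge0 ?mulr_ge0// ?divr_ge0 ?(ltW sc1)//.
  by rewrite addr_ge0.
move=> e r c he hr /andP[cl cu]; have /andP[e0 e1] := he.
have /andP[r0 r1] := hr.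
have c0 : 0 < c by exact: lt_le_trans cl.
have l1 := log_factor_ge1 _ _ he hr; set l := log_factor e r in l1 *.
have sc : 0 < Num.sqrt c by rewrite sqrtr_gt0.
have one : 1 <= Num.sqrt c / Num.sqrt c1.
  by rewrite ler_pdivlMr// mul1r ler_wsqrtr.
have lsc : 1 <= l * Num.sqrt c / Num.sqrt c1.
  by rewrite -mulrA -[X in X <= _]mulr1 ler_pM.
pose rho := growth_rate mubar Q c.
have rho0 : 0 < rho by rewrite sqrtr_gt0 divr_gt0// !mulr_gt0.
have irho : (ln (1 + rho))^-1 <= q1 * Num.sqrt c.
  apply: (le_trans (inv_ln1p_le _ rho0)); rewrite /q1 mulrDl mulrC lerD//.
  rewrite -sqrtrM ?divr_ge0 ?mulr_ge0 ?(ltW Q0) ?(ltW mubar0)//.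
  rewrite /rho /growth_rate -sqrtrV ?divr_ge0 ?mulr_ge0 ?(ltW Q0) ?(ltW mubar0) ?(ltW c0)//.
  rewrite (_ : (mubar / (4 * (Q * c)))^-1 = 4 * Q / mubar * c)//.
  by field; rewrite !gt_eqF.
have er0 : 0 < e * r by rewrite mulr_gt0.
have ier : 0 < (e * r)^-1 by rewrite invr_gt0.
have k0er : k0 / e <= k0 * (e * r)^-1.
  by rewrite ler_pM2l// lef_pV2 ?posrE// ler_piMr// ltW.
have ln1 : ln (Th / (e * r) ^+ 2 * (Q * c)) <= a1 * l.
  apply: ln_le_log_factor => //.
  - by rewrite mulr_gt0 ?divr_gt0 ?exprn_gt0// mulr_gt0.
  - by rewrite !mulr_gt0.
  rewrite -exprVn (_ : Th * Q * k0 * _ =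
    Th * (e * r)^-1 ^+ 2 * (Q * (k0 * (e * r)^-1))); last by ring.
  rewrite ler_pM2l; last by rewrite mulr_gt0 ?exprn_gt0.
  by rewrite ler_pM2l// (le_trans cu).
have ln2' : ln (Q * c / M0) <= a2 * l.
  apply: ln_le_log_factor => //.
  - by rewrite divr_gt0// mulr_gt0.
  - by rewrite divr_gt0// mulr_gt0.
  rewrite expr1 (_ : Q * k0 / M0 * _ = Q * (k0 * (e * r)^-1) / M0); last by ring.
  by rewrite ler_pM2r ?invr_gt0// ler_pM2l// (le_trans cu).
have cl_le : cycle_length M0 (Q * c) (Th / (e * r) ^+ 2) rho <=
    a3 * (l * Num.sqrt c).
  rewrite /cycle_length /iterations_left /doublings_left eqxx.
  have h1 : ln (Th / (e * r) ^+ 2 * (Q * c)) / ln (1 + rho) <=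
      a1 * l * (q1 * Num.sqrt c).
    apply: (@le_trans _ _ (a1 * l / ln (1 + rho))).
      by rewrite ler_wpM2r// invr_ge0 ln_ge0// lerDl ltW.
    by rewrite ler_wpM2l// mulr_ge0// (le_trans _ l1).
  have h2 : ln (Q * c / M0) / ln 2 <= a2 / ln 2 * (l * Num.sqrt c / Num.sqrt c1).
    apply: (@le_trans _ _ (a2 * l / ln 2)).
      by rewrite ler_wpM2r// invr_ge0 ltW.
    rewrite mulrAC ler_wpM2l//; first by rewrite divr_ge0// ltW.
    by rewrite -mulrA ler_peMr// (le_trans _ l1).
  have -> : a3 * (l * Num.sqrt c) = 4 * (l * Num.sqrt c / Num.sqrt c1) +
     a2 / ln 2 * (l * Num.sqrt c / Num.sqrt c1) + a1 * l * (q1 * Num.sqrt c).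
    by rewrite /a3; field; rewrite !gt_eqF.
  lra.
rewrite /=; have := ler_wpM2r (_ : 0 <= 1 + cycles_left mubar mu0) cl_le.
rewrite addr_ge0// => /(_ isT) h.
have -> : (3 * a3 * (1 + cycles_left mubar mu0) + 2 / Num.sqrt c1) * l *
    Num.sqrt c = 3 * (a3 * (l * Num.sqrt c) * (1 + cycles_left mubar mu0))
    + 2 * (l * Num.sqrt c / Num.sqrt c1).
  by field; rewrite !gt_eqF.
rewrite -/rho; move: h lsc; rewrite -[3 * _ * _]mulrA; lra.
Qed.

(** * The complexity estimate *)
Lemma compact_diameter (R : realType) (E : normedModType R) (D : set E) :
  compact D -> exists2 d, 0 < d & forall x y, D x -> D y -> `|x - y| <= d.
Proof.
move=> /compact_bounded[M [_ MD]]; exists (2 * (`|M| + 1)).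
  by rewrite mulr_gt0// ltr_wpDl.
have le x : D x -> `|x| <= `|M| + 1.
  by apply: MD; rewrite (le_lt_trans (ler_norm M))// ltrDl.
move=> x y Dx Dy; apply: (le_trans (ler_normB _ _)).
by have := le _ Dx; have := le _ Dy; lra.
Qed.

Lemma interior_closed_ball (R : realType) (E : normedModType R) (D : set E) x :
  interior D x -> exists2 d, 0 < d & forall z, `|z - x| <= d -> D z.
Proof.
move=> /nbhs_ballP[d /= d0 dD]; exists (d / 2); first by rewrite divr_gt0.
move=> z zx; apply: dD; rewrite -ball_normE /= distrC (le_lt_trans zx)//; lra.
Qed.

Lemma opnorm_gt0 (R : realType) (E : normedModType R) (m : nat)
    (A : {linear E -> 'cV[R]_m}) k :
  (forall z, enorm (A z) <= k * `|z|) -> (exists z, A z != 0) ->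
  0 <= k -> 0 < opnorm A.
Proof.
move=> Ak [z Az] k0.
have z0 : 0 < `|z| by rewrite normr_gt0; apply: contraNneq Az => ->; rewrite linear0.
apply: (@lt_le_trans _ _ (enorm (A (`|z|^-1 *: z)))).
  by rewrite linearZ enormZ gtr0_norm ?invr_gt0// mulr_gt0 ?invr_gt0// enorm_gt0.
apply: ub_le_sup.
  exists k => _ [x x1 <-]; apply: (le_trans (Ak x)).
  by rewrite -[leRHS]mulr1 ler_wpM2l.
exists (`|z|^-1 *: z) => //=.
by rewrite normrZ gtr0_norm ?invr_gt0// mulVf// gt_eqF.
Qed.

Lemma diam_set_ge (R : realType) (E : normedModType R) (D : set E) d x y :
  (forall x y, D x -> D y -> `|x - y| <= d) -> D x -> D y ->
  `|x - y| <= diam_set D.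
Proof.
move=> hd Dx Dy; apply: ub_le_sup; last by exists x, y.
by exists d => _ [u [v [Du Dv ->]]]; exact: hd.
Qed.

(** The parameters of the outer loop are chosen so that [cstar] is a multiple of
    [1 / ehat] and [Amax] a multiple of [1 / (ehat * rhat)^2]. *)
Lemma apf_sqrt_log_complexity (R : realType) (E : normedModType R)
  (ip : {dot E for idfun}) (hE : is_euclidean ip)
  (m : nat) (A : {linear E -> 'cV[R]_m})
  (b : 'cV[R]_m)
  (psi_s : E -> R) (Lbar : R) (hLbar : 0 < Lbar)
  (hs_convex : convex_fun (fun z => (psi_s z)%:E))
  (hs_diff : forall z, differentiable (psi_s : E -> R^o) z)
  (hs_lip : Lbar.-lipschitz (grad ip psi_s))
  (psi_n : E -> \bar R) (hn_proper : proper_fun psi_n)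
  (hn_convex : convex_fun psi_n) (hn_dom : compact (effdom psi_n))
  (mubar : R) (hmubar : 0 < mubar)
  (hpsi : strongly_convex_fun mubar (fun z => ((psi_s z)%:E + psi_n z)%E))
  (Mn : R) (hn_lip : Mn.-lipschitz_(effdom psi_n) (fun z => fine (psi_n z) : R^o))
  (zbar : E) (hzbar : interior (effdom psi_n) zbar) (hAzbar : A zbar = b)
  (z0 : E) (hz0 : effdom psi_n z0) (p0 : 'cV[R]_m)
  (c1 : R) (hc1 : 0 < c1) (alpha : R) (halpha : 1 < alpha)
  (omega : R) (homega : 1 < omega) (et1 : R)
  (chi : R) (hchi : 0 < chi < 1) (mu0 : R) (hmu0 : mubar <= mu0)
  (M0 : R) (hM0 : 0 < M0) :
  exists2 C, 0 <= C & forall ehat rhat,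
    0 < ehat <= 1 -> 0 < rhat <= 1 -> rhat <= et1 ->
    exists2 N : nat,
      apf_solves_within ip A b psi_s psi_n chi mu0 M0 alpha omega
         z0 p0 c1 et1 ehat rhat N
     & N%:R <= C * log_factor ehat rhat / Num.sqrt ehat.
Proof.
(* the multiplier bound needs et1 > 0, which 0 < rhat <= et1 provides *)
have [et0|et0] := leP et1 0.
  exists 0 => // e r _ /andP[r0 _] re.
  by have := lt_le_trans r0 (le_trans re et0); rewrite ltxx.
have [kA kA0 A_le] := linear_enorm_bounded ip hE A.
have [kR kR0 preim] := bounded_preimage ip hE A.
have [del del0 slater] := interior_closed_ball _ _ _ _ hzbar.
have [Dm Dm0 D_bd] := compact_diameter _ _ _ hn_dom.
pose gs := `|grad ip psi_s z0| + Lbar * Dm.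
have gs0 : 0 <= gs by rewrite addr_ge0// mulr_ge0// ltW.
have grad_le z : effdom psi_n z -> `|grad ip psi_s z| <= gs.
  move=> Dz; rewrite -[grad ip psi_s z](subrK (grad ip psi_s z0)).
  apply: (le_trans (ler_normD _ _)); rewrite addrC lerD2l.
  apply: (le_trans (grad_lipschitz ip psi_s Lbar hs_lip _ _)).
  by rewrite ler_wpM2l ?(ltW hLbar)// D_bd.
pose B := 2 * enorm p0 + kR / del * ((`|Mn| + (et1 + gs)) * Dm).
have B0 : enorm p0 <= B.
  have : 0 <= kR / del * ((`|Mn| + (et1 + gs)) * Dm).
    rewrite mulr_ge0 ?divr_ge0 ?(ltW kR0) ?(ltW del0)// mulr_ge0 ?(ltW Dm0)//.
    by rewrite addr_ge0// addr_ge0// ltW.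
  by rewrite /B; have := enorm_ge0 p0; lra.
have Bge0 : 0 <= B by exact: le_trans (enorm_ge0 _) B0.
have chi1 : 0 < 1 - chi by rewrite subr_gt0; case/andP: hchi.
have chi0 : 0 < chi by case/andP: hchi.
have al0 : 0 < alpha by exact: lt_trans halpha.
pose Q := (M0 + 8 * Lbar / (1 - chi)) / c1 + 8 * kA ^+ 2 / (1 - chi).
have Q0 : 0 < Q.
  have kA2 : 0 <= 8 * kA ^+ 2 / (1 - chi).
    by apply: divr_ge0; [rewrite mulr_ge0// sqr_ge0|exact: ltW].
  by rewrite ltr_pwDl// divr_gt0// addr_gt0// divr_gt0// mulr_gt0.
have Q_ge c : c1 <= c -> M0 + 8 * (Lbar + c * kA ^+ 2) / (1 - chi) <= Q * c.
  move=> cc; have -> : M0 + 8 * (Lbar + c * kA ^+ 2) / (1 - chi) =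
    (M0 + 8 * Lbar / (1 - chi)) + 8 * kA ^+ 2 / (1 - chi) * c.
    by field; rewrite gt_eqF.
  rewrite /Q [leRHS]mulrDl lerD2r [leRHS]mulrAC ler_pdivlMr// ler_pM2l//.
  by rewrite addr_gt0// divr_gt0// mulr_gt0.
pose kap := alpha ^+ 2 * (2 * B + c1).
have kap0 : 0 < kap.
  by rewrite mulr_gt0 ?exprn_gt0// ltr_wpDl// mulr_ge0.
(* the summand M0^-1 serves the requirement 1 <= Amax * M0 *)
pose Th := 4 * Q ^+ 2 * kap ^+ 2 * Dm ^+ 2 / (chi * M0) + M0^-1.
have T1 : 0 <= 4 * Q ^+ 2 * kap ^+ 2 * Dm ^+ 2 / (chi * M0).
  apply: divr_ge0; last by rewrite mulr_ge0 ?(ltW chi0) ?(ltW hM0).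
  by rewrite mulr_ge0 ?sqr_ge0// mulr_ge0 ?sqr_ge0// mulr_ge0 ?sqr_ge0.
have Th0 : 0 < Th by rewrite ltr_wpDl// invr_gt0.
have [K K0 Kc] := inner_cost_bound R E M0 mubar mu0 Q Th kap c1
  hM0 hmubar hmu0 Q0 Th0 kap0 hc1.
have sa : 0 < Num.sqrt alpha - 1 by rewrite subr_gt0 -[ltLHS]sqrtr1 ltr_sqrt.
pose G := K * Num.sqrt alpha / (Num.sqrt alpha - 1) * Num.sqrt kap.
have G0 : 0 <= G.
  by rewrite mulr_ge0 ?sqrtr_ge0// divr_ge0 ?(ltW sa)// mulr_ge0 ?sqrtr_ge0.
exists (4 + K * Num.sqrt c1 + G).
  by rewrite !addr_ge0// mulr_ge0 ?sqrtr_ge0.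
move=> e r he hr re; have /andP[e0 e1] := he; have /andP[r0 r1] := hr.
have l1 := log_factor_ge1 _ _ he hr; set l := log_factor e r in l1 *.
have lge0 : 0 <= l by exact: le_trans l1.
pose cstar := (2 * B + c1) / e.
have capE : alpha ^+ 2 * cstar = kap / e by rewrite /kap /cstar mulrA.
have cs1 : c1 <= cstar.
  rewrite ler_pdivlMr// (le_trans (_ : _ <= c1))//.
    by rewrite ler_piMr// ltW.
  by rewrite lerDr mulr_ge0.
pose Amax := Th / (e * r) ^+ 2.
have Am c : c1 <= c <= alpha ^+ 2 * cstar ->
    4 * (Q * c) ^+ 2 * Dm ^+ 2 <= Amax * (chi * M0 * r ^+ 2).
  rewrite capE => /andP[cl cu]; have c0 : 0 < c by exact: lt_le_trans cl.
  apply: (@le_trans _ _ (4 * Q ^+ 2 * kap ^+ 2 * Dm ^+ 2 / e ^+ 2)).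
    rewrite (_ : _ / e ^+ 2 = 4 * (Q * (kap / e)) ^+ 2 * Dm ^+ 2); last first.
      by field; rewrite gt_eqF.
    have n1 : 0 <= Q * c by rewrite mulr_ge0 ?(ltW Q0) ?(ltW c0).
    have n2 : 0 <= Q * (kap / e).
      by rewrite mulr_ge0 ?(ltW Q0)// divr_ge0 ?(ltW kap0) ?(ltW e0).
    rewrite ler_wpM2r ?sqr_ge0// ler_wpM2l// ler_pXn2r ?nnegrE//.
    by rewrite ler_pM2l.
  have -> : Amax * (chi * M0 * r ^+ 2) = 4 * Q ^+ 2 * kap ^+ 2 * Dm ^+ 2 / e ^+ 2
     + chi / e ^+ 2.
    by rewrite /Amax /Th; field; rewrite !gt_eqF.
  by rewrite lerDl divr_ge0 ?sqr_ge0// ltW.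
have Am1 : 1 <= Amax * M0.
  have : 1 <= (e * r)^-1 ^+ 2 by rewrite exprn_ege1// inv_mul_ge1.
  have -> : Amax * M0 = (e * r)^-1 ^+ 2 * (Th * M0).
    by rewrite /Amax; field; rewrite !gt_eqF.
  have : 1 <= Th * M0.
    by rewrite /Th mulrDl mulVf ?gt_eqF// lerDr mulr_ge0// ltW.
  by move=> x1 x2; rewrite -[leLHS]mulr1 ler_pM.
have Kpay c : c1 <= c <= alpha ^+ 2 * cstar ->
    rfista_potential (E := E) M0 mubar (Q * c) Amax (growth_rate mubar Q c)
      (NewCycle 1 M0 mu0) + 2 <= K * l * Num.sqrt c.
  by rewrite capE => cc; exact: Kc.
have [||N Ns NK] := apf_complexity_bound ip hE A b psi_s Lbar hLbar hs_convex
  hs_diff hs_lip psi_n Mn mubar hn_proper hn_convex hn_dom hmubar hpsi hn_lip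
  zbar z0 p0 c1 alpha omega et1 chi mu0 M0 e r hAzbar hz0 hc1 halpha homega hchi
  hmu0 hM0 e0 r0 re kA kR del Dm gs B Q cstar Amax (K * l) (ltW kA0) A_le D_bd
  kR0 preim del0 slater grad_le (lexx _) B0 _ cs1 Q_ge Am Am1 _ Kpay.
- by rewrite /cstar (mulrC e) divfK ?gt_eqF// lerDl ltW.
- by rewrite mulr_ge0.
exists N => //; apply: (le_trans NK).
have se0 : 0 < Num.sqrt e by rewrite sqrtr_gt0.
have se1 : 1 <= (Num.sqrt e)^-1.
  by rewrite invf_ge1// -sqrtr1 ler_wsqrtr.
have ls : 1 <= l / Num.sqrt e by rewrite -[leLHS]mulr1 ler_pM.
rewrite capE /outer_rate sqrtrM ?(ltW kap0)// sqrtrV ?(ltW e0)//.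
have -> : (4 + K * Num.sqrt c1 + G) * l / Num.sqrt e =
  4 * (l / Num.sqrt e) + K * l * Num.sqrt c1 * (Num.sqrt e)^-1 +
  K * l * Num.sqrt alpha / (Num.sqrt alpha - 1) *
    (Num.sqrt kap * (Num.sqrt e)^-1).
  by rewrite /G; field; rewrite !gt_eqF.
rewrite lerD2r lerD//; first lra.
by rewrite ler_peMr// mulr_ge0 ?sqrtr_ge0// mulr_ge0.
Qed.

Lemma log_factor_le_ln_plus2 (R : realType) (t x e r : R) :
  0 < e <= 1 -> 0 < r <= 1 -> 0 < t -> t * (e * r)^-1 <= x ->
  log_factor e r <= (2 + `|ln t|) * ln_plus2 x.
Proof.
move=> he hr t0 tx; have /andP[e0 _] := he; have /andP[r0 _] := hr.
have i0 : 0 < (e * r)^-1 by rewrite invr_gt0 mulr_gt0.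
have l1 : 1 <= ln_plus2 x by rewrite /ln_plus2 le_max lexx orbT.
have lx : ln t + ln (e * r)^-1 <= ln_plus2 x.
  rewrite -lnM ?posrE//; apply: (@le_trans _ _ (ln x)).
    by rewrite ler_ln ?posrE ?mulr_gt0// (lt_le_trans _ tx)// mulr_gt0.
  by rewrite /ln_plus2 le_max lexx.
have : `|ln t| <= `|ln t| * ln_plus2 x by rewrite ler_peMr.
have := ler_norm (- ln t); rewrite normrN /log_factor; lra.
Qed.

Lemma log_factor_diag (R : realType) (e : R) : 0 < e <= expR (- 1) ->
  log_factor e e <= 3 * ln e^-1.
Proof.
move=> /andP[e0 ee]; have le1 : 1 <= ln e^-1.
  by rewrite lnV ?posrE// lerNr -[leRHS]expRK ler_ln ?posrE// expR_gt0.
rewrite /log_factor invfM lnM ?posrE ?invr_gt0//; lra.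
Qed.

(** The number of cycles is at least 1, and the part of the bound in the
    number of outer iterations is nonnegative. *)
Lemma apf_bound_ge (R : realType) (E : normedModType R) (m : nat)
    (ip : E -> E -> R) (A : E -> 'cV[R]_m) (psi_s : E -> R)
    (psi_n : E -> \bar R) (mu0 alpha : R) (p0 : 'cV[R]_m)
    (c1 et1 e r Lbar mubar Mn : R) (zbar : E) :
  0 < e -> 0 < mubar -> 0 <= opnorm A ->
  opnorm A / Num.sqrt mubar / Num.sqrt e *
    ln_plus2 (diam_set (effdom psi_n) * (Lbar + opnorm A ^+ 2 / e) / r)
  <= apf_bound ip A psi_s psi_n mu0 alpha p0 c1 et1 e r Lbar mubar Mn zbar.
Proof.
move=> e0 m0 op0; rewrite /apf_bound.
have lp0 x : 0 <= ln_plus2 x :> R by rewrite /ln_plus2 le_max ler01 orbT.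
rewrite ler_wpM2r//.
have c1' : 1 <= ceilR (logb_plus2 2 (mu0 / mubar)).
  rewrite /ceilR -[leLHS]/(1%:~R) ler_int -(ler_int R).
  apply: le_trans (ceil_ge _).
  by rewrite /logb_plus2 le_max lexx orbT.
have ob0 : 0 <= outer_bound ip A psi_s psi_n alpha p0 c1 et1 e Mn zbar.
  rewrite /outer_bound addr_ge0// /ceilR ler0z.
  by rewrite -(ler_int R) (le_trans _ (ceil_ge _))// /logb_plus le_max lexx orbT.
have sq : Num.sqrt (opnorm A ^+ 2 / (e * mubar)) =
    opnorm A / Num.sqrt mubar / Num.sqrt e.
  rewrite sqrtrM ?sqr_ge0// sqrtr_sqr ger0_norm// sqrtrV ?mulr_ge0 ?ltW//.
  by rewrite sqrtrM ?(ltW e0)// invfM mulrA mulrAC.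
rewrite -{}sq; set q := Num.sqrt (opnorm A ^+ 2 / _).
have q0 : 0 <= q by exact: sqrtr_ge0.
apply: (@le_trans _ _ (1 * (0 + q))); first by rewrite mul1r add0r.
apply: ler_pM => //; first by rewrite add0r.
by rewrite lerD2r mulr_ge0// sqrtr_ge0.
Qed.

Theorem theorem3p7 (R : realType) (E : normedModType R)
  (ip : {dot E for idfun}) (hE : is_euclidean ip)
  (m : nat) (A : {linear E -> 'cV[R]_m}) (hA : exists z, A z != 0)
  (b : 'cV[R]_m)
  (psi_s : E -> R) (Lbar : R) (hLbar : 0 < Lbar)
  (hs_convex : convex_fun (fun z => (psi_s z)%:E))
  (hs_diff : forall z, differentiable (psi_s : E -> R^o) z)
  (hs_lip : Lbar.-lipschitz (grad ip psi_s))
  (psi_n : E -> \bar R)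
  (hn_closed : closed_fun psi_n) (hn_proper : proper_fun psi_n)
  (hn_convex : convex_fun psi_n) (hn_dom : compact (effdom psi_n))
  (mubar : R) (hmubar : 0 < mubar)
  (hpsi : strongly_convex_fun mubar (fun z => ((psi_s z)%:E + psi_n z)%E))
  (Mn : R) (hn_lip : Mn.-lipschitz_(effdom psi_n) (fun z => fine (psi_n z) : R^o))
  (zbar : E) (hzbar : interior (effdom psi_n) zbar) (hAzbar : A zbar = b)
  (z0 : E) (hz0 : effdom psi_n z0) (p0 : 'cV[R]_m)
  (c1 : R) (hc1 : 0 < c1) (alpha : R) (halpha : 1 < alpha)
  (omega : R) (homega : 1 < omega) (et1 : R)
  (chi : R) (hchi : 0 < chi < 1) (mu0 : R) (hmu0 : mubar <= mu0)
  (M0 : R)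
  (hM0 : (exists w0 : E,
            [/\ effdom psi_n w0, w0 <> z0, grad ip psi_s w0 <> grad ip psi_s z0
              & M0 = `|grad ip psi_s z0 - grad ip psi_s w0|
                     / (4 * `|z0 - w0|)])
         \/ (affine_fun ip psi_s /\ 0 < M0 <= 2 * Lbar)) :
  (exists C : R, forall ehat rhat : R,
     0 < ehat <= 1 -> 0 < rhat <= 1 -> rhat <= et1 ->
     exists2 N : nat,
       apf_solves_within ip A b psi_s psi_n chi mu0 M0 alpha omega
         z0 p0 c1 et1 ehat rhat N
     & N%:R <= C * (1 + apf_bound ip A psi_s psi_n mu0 alpha p0 c1 et1
                          ehat rhat Lbar mubar Mn zbar))
  /\
  (exists C : R, \forall e \near 0^'+, e <= et1 ->
     exists2 N : nat,
       apf_solves_within ip A b psi_s psi_n chi mu0 M0 alpha omega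
         z0 p0 c1 et1 e e N
     & N%:R <= C * (e `^ (- 2^-1) * ln e^-1)).
Proof.
have M0_gt0 : 0 < M0.
  case: hM0 => [[w0 [_ wz gw ->]]|[_ /andP[]//]].
  have gd : 0 < `|grad ip psi_s z0 - grad ip psi_s w0|.
    by rewrite normr_gt0 subr_eq0 eq_sym; apply/eqP.
  by rewrite divr_gt0// mulr_gt0// normr_gt0 subr_eq0 eq_sym; apply/eqP.
have [C C0 bound] := apf_sqrt_log_complexity R E ip hE m A b psi_s Lbar hLbar
  hs_convex hs_diff hs_lip psi_n hn_proper hn_convex hn_dom mubar hmubar hpsi
  Mn hn_lip zbar hzbar hAzbar z0 hz0 p0 c1 hc1 alpha halpha omega homega et1
  chi hchi mu0 hmu0 M0 M0_gt0.
split.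
  have [kA kA0 A_le] := linear_enorm_bounded ip hE A.
  have op0 := opnorm_gt0 _ _ _ _ _ A_le hA (ltW kA0).
  have [del del0 slater] := interior_closed_ball _ _ _ _ hzbar.
  have [Dm Dm0 D_bd] := compact_diameter _ _ _ hn_dom.
  have D0 : 0 < diam_set (effdom psi_n).
    have [z Az] := hA.
    have z0' : 0 < `|z|.
      by rewrite normr_gt0; apply: contraNneq Az => ->; rewrite linear0.
    pose u := zbar + (del / `|z|) *: z.
    have uz : `|u - zbar| = del.
      rewrite /u addrAC subrr add0r normrZ gtr0_norm ?divr_gt0// divfK//.
      by rewrite gt_eqF.
    have Du : effdom psi_n u by apply: slater; rewrite uz.
    have Dz : effdom psi_n zbar by apply: slater; rewrite subrr normr0 ltW.
    by apply: lt_le_trans (diam_set_ge _ _ _ _ _ _ D_bd Du Dz); rewrite uz.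
  have sm0 : 0 < Num.sqrt mubar by rewrite sqrtr_gt0.
  pose t := diam_set (effdom psi_n) * opnorm A ^+ 2.
  have t0 : 0 < t by rewrite mulr_gt0 ?exprn_gt0.
  pose k := (2 + `|ln t|) * (Num.sqrt mubar / opnorm A).
  have k0 : 0 <= k.
    by rewrite mulr_ge0 ?addr_ge0// divr_ge0 ?sqrtr_ge0// ltW.
  exists (C * k) => e r he hr re; have [N Ns NC] := bound e r he hr re.
  exists N => //; apply: (le_trans NC).
  have /andP[e0 _] := he; have /andP[r0 _] := hr.
  have se0 : 0 < Num.sqrt e by rewrite sqrtr_gt0.
  rewrite -(mulrA C (log_factor e r)) -(mulrA C k) ler_wpM2l//.
  set X := diam_set (effdom psi_n) * (Lbar + opnorm A ^+ 2 / e) / r.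
  have lf : log_factor e r <= (2 + `|ln t|) * ln_plus2 X.
    apply: log_factor_le_ln_plus2 => //.
    have -> : t * (e * r)^-1 =
        diam_set (effdom psi_n) * (opnorm A ^+ 2 / e) / r.
      by rewrite /t; field; rewrite !gt_eqF.
    by rewrite ler_pM2r ?invr_gt0// ler_pM2l// lerDr ltW.
  have ge := apf_bound_ge R E m ip A psi_s psi_n mu0 alpha p0 c1 et1 e r
    Lbar mubar Mn zbar e0 hmubar (ltW op0).
  rewrite -/X in ge.
  have kge := ler_wpM2l k0 ge; rewrite mulrDr mulr1.
  apply: (@le_trans _ _ ((2 + `|ln t|) * ln_plus2 X / Num.sqrt e)).
    by rewrite ler_pM2r ?invr_gt0.
  rewrite -[leLHS]add0r lerD//; apply: le_trans kge.
  rewrite le_eqVlt; apply/orP; left; apply/eqP.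
  by rewrite /k; field; rewrite !gt_eqF.
exists (3 * C); near=> e => re.
have e0 : 0 < e by near: e; exact: nbhs_right_gt.
have ee : e <= expR (- 1) by near: e; apply: nbhs_right_le; rewrite expR_gt0.
have e1 : e <= 1.
  by apply: (le_trans ee); rewrite -expR0 ler_expR oppr_le0.
have he : 0 < e <= 1 by rewrite e0.
have [N Ns NC] := bound e e he he re; exists N => //; apply: (le_trans NC).
rewrite powRN powR12_sqrt ?(ltW e0)//.
have le : log_factor e e <= 3 * ln e^-1 by apply: log_factor_diag; rewrite e0.
rewrite [leRHS](_ : _ = C * (3 * ln e^-1) / Num.sqrt e); last by ring.
by rewrite ler_wpM2r ?invr_ge0 ?sqrtr_ge0// ler_wpM2l.
Unshelve. all: by end_near.
Qed.
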